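(* For every $\varepsilon>0$ and $m,n\in\mathbb{N}$ we have $$f_4(m,n)\ll_{\varepsilon}\begin{cases} n^{\varepsilon}\,\dfrac{n^{3/2}}{m^{3/4}} & \text{if } m\ll n^{50/289},\\[2mm] n^{\varepsilon}\,\dfrac{n^{28/17}}{m^{8/5}} & \text{if } n^{50/289}\ll m\ll n^{5/17},\\[2mm] n^{\varepsilon}\left(\dfrac{n}{m}\right)^{5/3} & \text{if } n^{5/17}\ll m\ll n^{1/3},\\[2mm] n^{\varepsilon}\,\dfrac{n^{4/3}}{m^{2/3}} & \text{if } n^{1/3}\ll m\ll n^{4/5},\\[2mm] n^{\varepsilon}\,\dfrac{n^{8/5}}{m} & \text{if } n^{4/5}\ll m\ll n.\end{cases}$$
   Context: $\mathbb{N}$ denotes the positive integers. For $k,m,n\in\mathbb{N}$, $$f_k(m,n)=\left|\left\{(a_1,\ldots,a_k)\in\mathbb{N}^k:\ a_1\le\cdots\le a_k,\ \frac{m}{n}=\sum_{i=1}^k\frac1{a_i}\right\}\right|.$$ $A\ll B$ is Vinogradov notation: $A\le CB$ for a positive constant $C$. The constant implied by $\ll_\varepsilon$ in the conclusion depends only on $\varepsilon$ and on the constants implied in the conditions on $m$ in the respective case; it does not depend on $m,n$. *)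

(* Defs.v *)
From HB Require Import structures.
From mathcomp Require Import all_boot all_order all_algebra.
From mathcomp Require Import finmap.
From mathcomp Require Import all_classical all_reals all_analysis.

Set Implicit Arguments.
Unset Strict Implicit.
Unset Printing Implicit Defensive.

Import Order.TTheory GRing.Theory Num.Theory.

Local Open Scope classical_set_scope.
Local Open Scope ring_scope.

Definition egyptian_reps (k : nat) (q : rat) : set (k.-tuple nat) :=
  [set a : k.-tuple nat |
    [/\ forall i : 'I_k, (0 < tnth a i)%N,
        forall i j : 'I_k, (i <= j)%N -> (tnth a i <= tnth a j)%N
      & q = \sum_(i < k) ((tnth a i)%:R)^-1]].
Arguments egyptian_reps : clear implicits.

(* [fset_set] is [fset0] on infinite sets; this junk value never occurs. *)
Lemma finite_egyptian_reps (k : nat) (q : rat) : finite_set (egyptian_reps k q).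
Proof.
elim: k q => [|k IHk] q.
  apply: (@sub_finite_set _ _ [set [tuple]]); last exact: finite_set1.
  by move=> a _ /=; rewrite tuple0.
have [q0|q0] := leP q 0.
  apply: (@sub_finite_set _ _ set0); last exact: finite_set0.
  move=> a [a0 _ qE]; move: q0; apply/negP; rewrite -ltNge qE.
  rewrite big_ord_recl ltr_pwDl ?invr_gt0 ?ltr0n//.
  by apply: sumr_ge0 => i _; rewrite invr_ge0 ler0n.
pose N := Num.bound (k.+1%:R / q).
apply: (@sub_finite_set _ _
  (\bigcup_(x in `I_N)
     (fun t : k.-tuple nat => [tuple of x :: t]) @`
       egyptian_reps k (q - x%:R^-1))); last first.
  apply: bigcup_finite; first exact: finite_II.
  by move=> x _; apply: finite_image.
move=> a [a0 amono qE].
have a0gt : (0 : rat) < (tnth a ord0)%:R by rewrite ltr0n.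
exists (tnth a ord0) => /=.
  rewrite -(ltr_nat rat); apply: (@le_lt_trans _ _ (k.+1%:R / q)); last first.
    by apply: archi_boundP; rewrite divr_ge0 ?ler0n// ltW.
  rewrite ler_pdivlMr// -ler_pdivlMl// mulrC qE.
  rewrite [leRHS](_ : _ = \sum_(i < k.+1) (tnth a ord0)%:R^-1); last first.
    by rewrite sumr_const card_ord mulr_natl.
  apply: ler_sum => i _.
  by rewrite lef_pV2 ?posrE ?ltr0n// ler_nat amono.
exists [tuple of behead a]; last first.
  by rewrite [RHS]tuple_eta; apply: val_inj.
have tE (i : 'I_k) : tnth [tuple of behead a] i = tnth a (lift ord0 i).
  by rewrite tnth_behead; congr tnth; apply: val_inj; rewrite /= inordK// ltnS.
split=> [i|i j ij|].
- by rewrite tE.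
- by rewrite !tE amono.
- rewrite qE big_ord_recl addrAC subrr add0r.
  by apply: eq_bigr => i _; rewrite tE.
Qed.

Definition f (k m n : nat) : nat :=
  #|` fset_set (egyptian_reps k (m%:R / n%:R)) |.

(* Main.v *)
(* Write the solution with a_1 <= a_2 <= a_3 <= a_4, n_i = gcd(a_i, n),
   c_i = n / n_i and t_i = a_i / n_i, so that m is the sum of the reduced
   fractions c_i / t_i.  Hence t_i divides the lcm of the other t_j, and the
   t_i are products of eleven parameters p_ij, T_i, q indexed by the sets of at
   least two indices.  Certain products s of parameters determine a_1 and a_2
   up to divisors of bounded quantities, i.e. up to n^eps choices, so at most
   T n^eps solutions have such an s <= T.  With J = a_1 - floor(n / m) the
   products are
     s_1 = J p_23 T_1,
     s_2 = all parameters except p_14, p_23 and T_1,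
     s_3 = g W, where m - c_1/t_1 - c_2/t_2 = g W / (t_1 t_2) and
           g = gcd(t_1, t_2),
   and, if J = 1 (so that a_1 is known), also
     s_4 = p_23 p_24,   s_5 = W,   s_6 = w_14 / gcd(c_2, c_3),
   where p_14 w_14 is defined for the indices 1, 4 as W is for 1, 2.  Since
     s_1^2 s_2 s_3 <= 2 n J^2 t_1 t_2^2 << n^6 / m^5          (J >= 2),
     s_1^2 s_4 s_5 s_6 <= 4 n t_1 t_2^2 << n^6 / m^3          (J = 1),
   some s is small, whence for all m and n
     f_4(m, n) << n^eps (n^(3/2) / m^(5/4) + n^(6/5) / m^(3/5)),
   which is at least as strong as the claim in each of the five ranges. *)
Require Import Defs.
From HB Require Import structures.
From mathcomp Require Import all_boot all_order all_algebra.
From mathcomp Require Import finmap.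
From mathcomp Require Import all_classical all_reals all_analysis.
From mathcomp Require Import zify ring lra.

Set Implicit Arguments.
Unset Strict Implicit.
Unset Printing Implicit Defensive.

Import Order.TTheory GRing.Theory Num.Theory.

(** * The divisor bound *)

(** Each divisor [d] of [a * b] is [gcdn d a], a divisor of [a], times [d %/ gcdn d a], which is
    coprime to [a %/ gcdn d a] and hence divides [b]. *)
Lemma size_divisorsM (a b : nat) : 0 < a -> 0 < b ->
  size (divisors (a * b)) <= size (divisors a) * size (divisors b).
Proof.
move=> a0 b0; rewrite -(size_allpairs muln).
apply: (uniq_leq_size (divisors_uniq _)) => d.
rewrite -dvdn_divisors ?muln_gt0 ?a0// => dab.
have g0 : 0 < gcdn d a by rewrite gcdn_gt0 a0 orbT.
rewrite -(divnK (dvdn_gcdl d a)) mulnC; apply: allpairs_f.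
  by rewrite -dvdn_divisors ?dvdn_gcdr.
rewrite -dvdn_divisors// -(@Gauss_dvdr _ (a %/ gcdn d a)).
  by rewrite dvdn_divLR ?dvdn_gcdl// mulnAC divnK ?dvdn_gcdr.
rewrite /coprime -(eqn_pmul2r g0) mul1n muln_gcdl.
by rewrite !divnK ?dvdn_gcdl ?dvdn_gcdr.
Qed.

Lemma size_divisors_pfactor (p e : nat) :
  prime p -> size (divisors (p ^ e)) <= e.+1.
Proof.
move=> pp; rewrite -[leqRHS](size_iota 0) -[leqRHS](size_map (expn p)).
apply: (uniq_leq_size (divisors_uniq _)) => d.
rewrite -dvdn_divisors ?expn_gt0 ?prime_gt0// => /(dvdn_pfactor _ _ pp)[i ie ->].
by apply: map_f; rewrite mem_iota.
Qed.

(** Raise [e.+1 <= r * (e %/ r).+1 <= r * 2 ^ (e %/ r)] to the power [r]. *)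
Lemma succ_exp_le (r e : nat) : 0 < r -> e.+1 ^ r <= r ^ r * 2 ^ e.
Proof.
move=> r0; apply: (@leq_trans ((r * 2 ^ (e %/ r)) ^ r)).
  rewrite leq_exp2r//; apply: (@leq_trans (r * (e %/ r).+1)).
    by rewrite {1}(divn_eq e r) mulnS mulnC addnC ltn_add2r ltn_mod.
  by rewrite leq_mul2l ltn_expl// orbT.
by rewrite expnMn -expnM leq_mul2l leq_exp2l// leq_divM orbT.
Qed.

(** Induction on [N], splitting off the prime [N] with its exponent [e]. If [N < 2 ^ r], the factor
    [e.+1 ^ r] costs [r ^ r] by [succ_exp_le]; if [N >= 2 ^ r], then
    [e.+1 ^ r <= 2 ^ (e * r) <= N ^ e] costs nothing. So [minn N (2 ^ r)] bounds the number of
    costly primes. *)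
Lemma size_divisors_smooth (r N k : nat) : 0 < r -> 0 < k ->
  (forall p, prime p -> p %| k -> p < N) ->
  size (divisors k) ^ r <= (r ^ r) ^ minn N (2 ^ r) * k.
Proof.
move=> r0; have rr0 : 0 < r ^ r by rewrite expn_gt0 r0.
elim: N k => [|N IH] k k0 kN.
  have -> : k = 1.
    apply/eqP; case: eqVneq => // k1.
    by case: (pdivP (n := k)) => [|p /kN/[apply]//]; lia.
  by rewrite exp1n muln1 expn_gt0 rr0.
have mono : (r ^ r) ^ minn N (2 ^ r) <= (r ^ r) ^ minn N.+1 (2 ^ r).
  by rewrite leq_pexp2l//; lia.
have [Np|Np] := boolP (prime N); last first.
  apply: leq_trans (IH k k0 _) _; last by rewrite leq_mul2r mono orbT.
  move=> p pp pk; have := kN p pp pk; rewrite ltnS leq_eqVlt => /predU1P[pN|//].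
  by rewrite -pN pp in Np.
have [k' Nk' kE] := pfactor_coprime Np k0.
have k'0 : 0 < k' by move: k0; rewrite kE muln_gt0 => /andP[].
have {}IH : size (divisors k') ^ r <= (r ^ r) ^ minn N (2 ^ r) * k'.
  apply: IH => // p pp pk'; have := kN p pp; rewrite kE dvdn_mulr// => /(_ isT).
  rewrite ltnS leq_eqVlt => /predU1P[pN|//].
  by move: Nk'; rewrite prime_coprime// -pN pk'.
move: (logn N k) kE => e kE.
have Ne0 : 0 < N ^ e by rewrite expn_gt0 prime_gt0.
rewrite {1}kE; apply: leq_trans (_ : (size (divisors k') * e.+1) ^ r <= _).
  rewrite leq_exp2r//; apply: leq_trans (size_divisorsM _ _) _ => //.
  by rewrite leq_mul2l size_divisors_pfactor ?orbT.
rewrite expnMn kE mulnA.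
have [rN|rN] := leqP (2 ^ r) N.
  apply: leq_mul; first by apply: leq_trans IH _; rewrite leq_mul2r mono orbT.
  apply: leq_trans (_ : (2 ^ e) ^ r <= _); first by rewrite leq_exp2r// ltn_expl.
  by rewrite -expnM mulnC expnM; case: (e) => [|e']; rewrite ?expn0// leq_exp2r.
have -> : minn N.+1 (2 ^ r) = (minn N (2 ^ r)).+1 by lia.
rewrite expnS -(mulnA (r ^ r)) [leqRHS](_ : _ = (r ^ r) ^ minn N (2 ^ r) * k' * (r ^ r * N ^ e)).
  apply: leq_mul IH _; apply: leq_trans (succ_exp_le _ r0) _.
  rewrite leq_mul2l; apply/orP; right.
  by case: (e) => [|e']; rewrite ?expn0// leq_exp2r// prime_gt1.
by rewrite !mulnA; congr (_ * _); rewrite -!mulnA mulnC !mulnA.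
Qed.

(** Integer form of the bound k^(1/r) for the number of divisors: at most [2 ^ r] primes are costly,
    uniformly in [k]. *)
Lemma size_divisors_bound (r : nat) : 0 < r ->
  exists2 C, 0 < C & forall k, 0 < k -> size (divisors k) ^ r <= C * k.
Proof.
move=> r0; have rr0 : 0 < r ^ r by rewrite expn_gt0 r0.
exists ((r ^ r) ^ (2 ^ r)) => [|k k0]; first by rewrite expn_gt0 rr0.
apply: leq_trans (size_divisors_smooth (N := k.+1) r0 k0 _) _.
  by move=> p _ /(dvdn_leq k0).
by rewrite leq_mul2r leq_pexp2l ?orbT// geq_minr.
Qed.

(** * Parametrization *)

Ltac dvdn_factor :=
  solve [exact: dvdnn | apply: dvdn_mull; dvdn_factor
        | apply: dvdn_mulr; dvdn_factor].

Lemma gcd_split2 (x y : nat) : 0 < x -> 0 < y ->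
  exists d x' y', [/\ x = d * x', y = d * y' & coprime x' y'].
Proof.
move=> x0 y0; have d0 : 0 < gcdn x y by rewrite gcdn_gt0 x0.
exists (gcdn x y), (x %/ gcdn x y), (y %/ gcdn x y).
split; rewrite 1?mulnC ?divnK ?dvdn_gcdl ?dvdn_gcdr//.
by rewrite /coprime -(eqn_pmul2r d0) mul1n muln_gcdl !divnK ?dvdn_gcdl ?dvdn_gcdr.
Qed.

(** The cofactors are only jointly coprime; factors shared by two of them are split off later. *)
Lemma gcd_split3 (x y z : nat) : 0 < x -> 0 < y -> 0 < z ->
  exists d x' y' z', [/\ x = d * x', y = d * y', z = d * z' &
    forall k, k %| x' -> k %| y' -> k %| z' -> k %| 1].
Proof.
move=> x0 y0 z0; have [g [x1 [y1 [xE yE c1]]]] := gcd_split2 x0 y0.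
have g0 : 0 < g by move: x0; rewrite xE muln_gt0 => /andP[].
have [d [g' [z' [gE zE c2]]]] := gcd_split2 g0 z0.
exists d, (g' * x1), (g' * y1), z'.
split=> [||//|k kx ky kz]; rewrite ?mulnA -?gE//.
rewrite -(eqP c2) dvdn_gcd kz andbT -[g']muln1 -(eqP c1) muln_gcdr.
by rewrite dvdn_gcd kx ky.
Qed.

Lemma gcd_split4 (x y z w : nat) : 0 < x -> 0 < y -> 0 < z -> 0 < w ->
  exists d x' y' z' w', [/\ x = d * x', y = d * y', z = d * z', w = d * w' &
    forall k, k %| x' -> k %| y' -> k %| z' -> k %| w' -> k %| 1].
Proof.
move=> x0 y0 z0 w0; have [g [x1 [y1 [z1 [xE yE zE c1]]]]] := gcd_split3 x0 y0 z0.
have g0 : 0 < g by move: x0; rewrite xE muln_gt0 => /andP[].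
have [d [g' [w' [gE wE c2]]]] := gcd_split2 g0 w0.
exists d, (g' * x1), (g' * y1), (g' * z1), w'.
split=> [|||//|k kx ky kz kw]; rewrite ?mulnA -?gE//.
suff kg : k %| g' by rewrite -(eqP c2) dvdn_gcd kg.
have cE : gcdn (gcdn x1 y1) z1 = 1.
  apply/eqP; rewrite -dvdn1; apply: c1; rewrite ?dvdn_gcdr//;
  by rewrite (dvdn_trans (dvdn_gcdl _ _))// ?dvdn_gcdl ?dvdn_gcdr.
by rewrite -[g']muln1 -cE !muln_gcdr !dvdn_gcd kx ky.
Qed.

Lemma coprimeP1 (x y : nat) :
  (forall k, k %| x -> k %| y -> k %| 1) -> coprime x y.
Proof. by move=> H; rewrite /coprime -dvdn1 H ?dvdn_gcdl ?dvdn_gcdr. Qed.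

Lemma dvdn_coprime_eq1 (d n : nat) : d %| n -> coprime d n -> d = 1.
Proof. by move=> dn; rewrite /coprime => /eqP <-; rewrite (gcdn_idPl dn). Qed.

Lemma coprime_factors (x y u v : nat) :
  coprime x y -> u %| x -> v %| y -> coprime u v.
Proof. by move=> xy ux vy; apply: coprime_dvdl ux _; apply: coprime_dvdr vy _. Qed.

Ltac dvdn_via := match goal with
  | H : is_true (dvdn ?k _) |- is_true (dvdn ?k _) =>
      solve [apply: (dvdn_trans H); dvdn_factor] end.
Ltac coprime_from H := solve [apply: (coprime_factors H); dvdn_factor
  | rewrite coprime_sym; apply: (coprime_factors H); dvdn_factor].
Ltac coprime_by H := solve [apply: coprimeP1 => ? ? ?; apply: H; dvdn_via].
Ltac copr := match goal with
 | C12 : is_true (coprime _ _) |- _ => coprime_from C12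
 | C0 : forall k, _ |- _ => coprime_by C0 end.

(* [p_ij] collects the primes common to [t_i] and [t_j] only, [T_i] those
   common to all but [t_i], and [q] those common to all four.  No factor
   private to a single [t_i] remains: [t_i] divides the lcm of the others,
   because the reduced fractions [c_j / t_j] add up to an integer. *)
Lemma four_fraction_param (m c1 c2 c3 c4 t1 t2 t3 t4 : nat) :
  0 < t1 -> 0 < t2 -> 0 < t3 -> 0 < t4 ->
  coprime c1 t1 -> coprime c2 t2 -> coprime c3 t3 -> coprime c4 t4 ->
  m * (t1 * t2 * t3 * t4) =
    c1 * (t2 * t3 * t4) + c2 * (t1 * t3 * t4) +
    c3 * (t1 * t2 * t4) + c4 * (t1 * t2 * t3) ->
  exists p12 p13 p14 p23 p24 p34, exists T1 T2 T3 T4 q,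
  [/\ [/\ t1 = p12 * p13 * p14 * T2 * T3 * T4 * q,
          t2 = p12 * p23 * p24 * T1 * T3 * T4 * q,
          t3 = p13 * p23 * p34 * T1 * T2 * T4 * q &
          t4 = p14 * p24 * p34 * T1 * T2 * T3 * q],
      coprime p14 p23 &
      m * (p12 * p13 * p14 * p23 * p24 * p34 * T1 * T2 * T3 * T4 * q) =
        c1 * (p23 * p24 * p34 * T1) + c2 * (p13 * p14 * p34 * T2) +
        c3 * (p12 * p14 * p24 * T3) + c4 * (p12 * p13 * p23 * T4)].
Proof.
move=> t1_0 t2_0 t3_0 t4_0 ct1 ct2 ct3 ct4 E.
(* Common factors are extracted from all four numbers, then from triples, then from pairs, each time
   from what is left; [r1], ..., [r4] remain at the end. *)
have [q [s1 [s2 [s3 [s4 [E1 E2 E3 E4 C0]]]]]] := gcd_split4 t1_0 t2_0 t3_0 t4_0.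
subst t1 t2 t3 t4; move: t1_0 t2_0 t3_0 t4_0; rewrite !muln_gt0.
case/andP=> q0 s1_0 /andP[_ s2_0] /andP[_ s3_0] /andP[_ s4_0].
have [T4 [a1 [a2 [a3 [E1 E2 E3 C4]]]]] := gcd_split3 s1_0 s2_0 s3_0.
subst s1 s2 s3; move: s1_0 s2_0 s3_0; rewrite !muln_gt0.
case/andP=> T4_0 a1_0 /andP[_ a2_0] /andP[_ a3_0].
have [T3 [b1 [b2 [b4 [E1 E2 E4 C3]]]]] := gcd_split3 a1_0 a2_0 s4_0.
subst a1 a2 s4; move: a1_0 a2_0 s4_0; rewrite !muln_gt0.
case/andP=> T3_0 b1_0 /andP[_ b2_0] /andP[_ b4_0].
have [T2 [d1 [d3 [d4 [E1 E3 E4 C2]]]]] := gcd_split3 b1_0 a3_0 b4_0.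
subst b1 a3 b4; move: b1_0 a3_0 b4_0; rewrite !muln_gt0.
case/andP=> T2_0 d1_0 /andP[_ d3_0] /andP[_ d4_0].
have [T1 [e2 [e3 [e4 [E2 E3 E4 C1]]]]] := gcd_split3 b2_0 d3_0 d4_0.
subst b2 d3 d4; move: b2_0 d3_0 d4_0; rewrite !muln_gt0.
case/andP=> T1_0 e2_0 /andP[_ e3_0] /andP[_ e4_0].
have [p12 [f1 [f2 [E1 E2 C12]]]] := gcd_split2 d1_0 e2_0.
subst d1 e2; move: d1_0 e2_0; rewrite !muln_gt0.
case/andP=> p12_0 f1_0 /andP[_ f2_0].
have [p13 [h1 [f3 [E1 E3 C13]]]] := gcd_split2 f1_0 e3_0.
subst f1 e3; move: f1_0 e3_0; rewrite !muln_gt0.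
case/andP=> p13_0 h1_0 /andP[_ f3_0].
have [p14 [r1 [f4 [E1 E4 C14]]]] := gcd_split2 h1_0 e4_0.
subst h1 e4; move: h1_0 e4_0; rewrite !muln_gt0.
case/andP=> p14_0 r1_0 /andP[_ f4_0].
have [p23 [h2 [h3 [E2 E3 C23]]]] := gcd_split2 f2_0 f3_0.
subst f2 f3; move: f2_0 f3_0; rewrite !muln_gt0.
case/andP=> p23_0 h2_0 /andP[_ h3_0].
have [p24 [r2 [h4 [E2 E4 C24]]]] := gcd_split2 h2_0 f4_0.
subst h2 f4; move: h2_0 f4_0; rewrite !muln_gt0.
case/andP=> p24_0 r2_0 /andP[_ h4_0].
have [p34 [r3 [r4 [E3 E4 C34]]]] := gcd_split2 h3_0 h4_0.
subst h3 h4; move: h3_0 h4_0; rewrite !muln_gt0.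
case/andP=> p34_0 r3_0 /andP[_ r4_0].
have {}E : m * (r1 * r2 * r3 * r4 *
    (p12 * p13 * p14 * p23 * p24 * p34 * T1 * T2 * T3 * T4 * q)) =
    c1 * (r2 * r3 * r4 * (p23 * p24 * p34 * T1)) +
    c2 * (r1 * r3 * r4 * (p13 * p14 * p34 * T2)) +
    c3 * (r1 * r2 * r4 * (p12 * p14 * p24 * T3)) +
    c4 * (r1 * r2 * r3 * (p12 * p13 * p23 * T4)).
  (* [K] is the quotient of [t1 * t2 * t3 * t4] by [r1 * r2 * r3 * r4] times the product of the
     eleven parameters. *)
  pose K := p12 * p13 * p14 * p23 * p24 * p34 * (T1 * T2 * T3 * T4) ^ 2 * q ^ 3.
  have K0 : 0 < K by rewrite /K !(muln_gt0, expn_gt0) p12_0 p13_0 p14_0 p23_0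
    p24_0 p34_0 T1_0 T2_0 T3_0 T4_0 q0.
  apply/eqP; rewrite -(eqn_pmul2l K0); apply/eqP; rewrite /K.
  transitivity (m * (q * (T4 * (T3 * (T2 * (p12 * (p13 * (p14 * r1)))))) *
    (q * (T4 * (T3 * (T1 * (p12 * (p23 * (p24 * r2))))))) *
    (q * (T4 * (T2 * (T1 * (p13 * (p23 * (p34 * r3))))))) *
    (q * (T3 * (T2 * (T1 * (p14 * (p24 * (p34 * r4))))))))); first by ring.
  by rewrite E; ring.
(* All other terms of [E] contain [r1], so [r1] divides the term of [c1]. It is coprime to [c1],
   being a factor of [t1], and to the remaining factors by the extraction. *)
have r1E : r1 = 1.
  apply: (@dvdn_coprime_eq1 _ (c1 * (r2 * r3 * r4 * (p23 * p24 * p34 * T1)))).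
    move/(congr1 (dvdn r1)): E.
    rewrite dvdn_addl; last by dvdn_factor.
    rewrite dvdn_addl; last by dvdn_factor.
    rewrite dvdn_addl; last by dvdn_factor.
    by move=> <-; dvdn_factor.
  rewrite !coprimeMr; do !(apply/andP; split); by copr.
have r2E : r2 = 1.
  apply: (@dvdn_coprime_eq1 _ (c2 * (r1 * r3 * r4 * (p13 * p14 * p34 * T2)))).
    move/(congr1 (dvdn r2)): E.
    rewrite dvdn_addl; last by dvdn_factor.
    rewrite dvdn_addl; last by dvdn_factor.
    rewrite dvdn_addr; last by dvdn_factor.
    by move=> <-; dvdn_factor.
  rewrite !coprimeMr; do !(apply/andP; split); by copr.
have r3E : r3 = 1.
  apply: (@dvdn_coprime_eq1 _ (c3 * (r1 * r2 * r4 * (p12 * p14 * p24 * T3)))).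
    move/(congr1 (dvdn r3)): E.
    rewrite dvdn_addl; last by dvdn_factor.
    rewrite dvdn_addr; last by rewrite dvdn_add//; dvdn_factor.
    by move=> <-; dvdn_factor.
  rewrite !coprimeMr; do !(apply/andP; split); by copr.
have r4E : r4 = 1.
  apply: (@dvdn_coprime_eq1 _ (c4 * (r1 * r2 * r3 * (p12 * p13 * p23 * T4)))).
    move/(congr1 (dvdn r4)): E.
    rewrite dvdn_addr; last by rewrite !dvdn_add//; dvdn_factor.
    by move=> <-; dvdn_factor.
  rewrite !coprimeMr; do !(apply/andP; split); by copr.
exists p12, p13, p14, p23, p24, p34, T1, T2, T3, T4, q.
rewrite r1E r2E r3E r4E; split; first by split; ring.
  by copr.
by move: E; rewrite r1E r2E r3E r4E !mul1n.
Qed.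

(** * Solutions determined by a key *)

Definition bind (T U : Type) (s : seq T) (e : T -> seq U) : seq U :=
  flatten [seq e x | x <- s].

Notation "'let*' x ':=' s 'in' e" := (bind s (fun x => e))
  (at level 200, x name, s at level 200, e at level 200).

Lemma mem_bind (T U : eqType) (x : T) (y : U) (s : seq T) (e : T -> seq U) :
  x \in s -> y \in e x -> y \in bind s e.
Proof. by move=> xs ye; apply/flatten_mapP; exists x. Qed.

Lemma size_bind (T U : Type) (s : seq T) (e : T -> seq U) (k l : nat) :
  size s <= k -> (forall x, size (e x) <= l) -> size (bind s e) <= k * l.
Proof.
move=> sk el; apply: (@leq_trans (size s * l)); last by rewrite leq_mul2r sk orbT.
elim: s {sk} => [|x s IH] //=.
by rewrite /bind /= size_cat mulSn leq_add.
Qed.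

(* Arguments above [B] are never met; discarding them makes the bound on the
   number of candidates unconditional. *)
Definition divs (B k : nat) : seq nat := if k <= B then divisors k else [::].

Definition max_divs (B : nat) : nat := \max_(k < B.+1) size (divisors k).

Lemma size_divs (B k : nat) : size (divs B k) <= max_divs B.
Proof.
rewrite /divs; case: ifP => // kB; rewrite -ltnS in kB.
exact: (leq_bigmax (F := fun k : 'I_B.+1 => size (divisors k)) (Ordinal kB)).
Qed.

Lemma max_divs_gt0 (B : nat) : 0 < max_divs B.
(* [divisors 0] is [[:: 1]], so the index 0 already contributes 1. *)
Proof. exact: leq_trans (size_divs B 0). Qed.

Lemma mem_divs (B d k : nat) : 0 < k -> k <= B -> d %| k -> d \in divs B k.
Proof. by move=> k0 kB dk; rewrite /divs kB -dvdn_divisors. Qed.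

(** Candidates for [x] in [D * x * y = A * y + C * x + E], where [d = D * x - A] divides
    [A * C + D * E]. *)
Definition hyperbola (B D A C E : nat) : seq nat :=
  [seq (d + A) %/ D | d <- divs B (A * C + D * E)].

Lemma size_hyperbola (B D A C E : nat) :
  size (hyperbola B D A C E) <= max_divs B.
Proof. by rewrite size_map size_divs. Qed.

(* [(D x - A) (D y - C) = A C + D E] *)
Lemma mem_hyperbola (B D A C E x y : nat) :
  D * x * y = A * y + C * x + E -> 0 < x -> 0 < A * C + D * E ->
  D * x * (D * y) <= B -> x \in hyperbola B D A C E.
Proof.
move=> eq x0 pos DB.
have E0 : 0 < C * x + E.
  (* If [E = 0], the positivity of [A * C + D * E] forces [C > 0]. *)
  case: (posnP E) pos => [->|E0 _]; last by rewrite ltn_addl.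
  by rewrite muln0 !addn0 !muln_gt0 x0 => /andP[_ ->].
(* Since [y * (D * x - A) = C * x + E > 0], the truncated difference [d] is exact. *)
have AD : A < D * x by nia.
pose d := D * x - A; have dE : D * x = d + A by rewrite /d subnK// ltnW.
have d0 : 0 < d by rewrite subn_gt0.
have D0 : 0 < D by case: (posnP D) AD => // ->.
have {}eq : d * (D * y) = A * C + D * E + C * d by nia.
apply/mapP; exists d; last by rewrite -dE mulKn.
apply: mem_divs => //; first by apply: leq_trans DB; nia.
have : d %| A * C + D * E + C * d by rewrite -eq dvdn_mulr.
by rewrite dvdn_addl// dvdn_mull.
Qed.

Lemma hyperbola_snd (D A C E x y : nat) :
  D * x * y = A * y + C * x + E -> 0 < C * x + E ->
  (C * x + E) %/ (D * x - A) = y.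
Proof.
move=> eq E0; have AD : A < D * x by nia.
have -> : C * x + E = y * (D * x - A) by rewrite mulnBr; nia.
by rewrite mulnK// subn_gt0.
Qed.

(* Each list below contains the pair [(a1, a2)] of every solution with the
   given [c_i] whose key, as named in the corresponding [mem_cand_*], is [s]. *)
Definition cand_pT (m n B c1 c2 c3 c4 s : nat) : seq (nat * nat) :=
  let* J := divs B s in let* p23 := divs B s in let* T1 := divs B s in
  let a1 := n %/ m + J in let t1 := a1 %/ (n %/ c1) in let u := m * t1 - c1 in
  let* p12 := divs B t1 in let* p13 := divs B t1 in let* p14 := divs B t1 in
  let* T2 := divs B t1 in let* T3 := divs B t1 in let* T4 := divs B t1 in
  let* q := divs B t1 in
  let* p24 := hyperbola B (u * (p23 * T1)) (c2 * (p13 * p14 * T2))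
    (c3 * (p12 * p14 * T3)) (c4 * (p12 * p13 * p23 * T4)) in
  [:: (a1, n %/ c2 * (p12 * p23 * p24 * T1 * T3 * T4 * q))].

Definition cand_key (m n B c1 c2 c3 c4 s : nat) : seq (nat * nat) :=
  let* p12 := divs B s in let* p13 := divs B s in let* p24 := divs B s in
  let* p34 := divs B s in let* T2 := divs B s in let* T3 := divs B s in
  let* T4 := divs B s in let* q := divs B s in
  let M := c2 * (p13 * p34 * T2) + c3 * (p12 * p24 * T3) in
  let* p23 := divs B M in
  let D := m * (p12 * p13 * p23 * p24 * p34 * T2 * T3 * T4 * q) in
  let A := c1 * (p23 * p24 * p34) in let E := c4 * (p12 * p13 * p23 * T4) in
  let* p14 := hyperbola B D A M E in
  let T1 := (M * p14 + E) %/ (D * p14 - A) in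
  [:: (n %/ c1 * (p12 * p13 * p14 * T2 * T3 * T4 * q),
       n %/ c2 * (p12 * p23 * p24 * T1 * T3 * T4 * q))].

Definition cand_gW (m n B c1 c2 c3 c4 s : nat) : seq (nat * nat) :=
  let* g := divs B s in let* W := divs B s in
  let* y1 := hyperbola B (m * g) c1 c2 W in
  let y2 := (c2 * y1 + W) %/ (m * g * y1 - c1) in
  [:: (n %/ c1 * (g * y1), n %/ c2 * (g * y2))].

Definition cand_pp (m n B c1 c2 c3 c4 s : nat) : seq (nat * nat) :=
  let* p23 := divs B s in let* p24 := divs B s in
  let a1 := (n %/ m).+1 in let t1 := a1 %/ (n %/ c1) in let u := m * t1 - c1 in
  let* p12 := divs B t1 in let* p13 := divs B t1 in let* p14 := divs B t1 in
  let* T2 := divs B t1 in let* T3 := divs B t1 in let* T4 := divs B t1 in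
  let* q := divs B t1 in
  let M := c3 * (p12 * p14 * p24 * T3) + c4 * (p12 * p13 * p23 * T4) in
  let* p34 := divs B M in
  let T1 := (c2 * (p13 * p14 * p34 * T2) + M) %/ (u * (p23 * p24 * p34)) in
  [:: (a1, n %/ c2 * (p12 * p23 * p24 * T1 * T3 * T4 * q))].

Definition cand_w12 (m n B c1 c2 c3 c4 s : nat) : seq (nat * nat) :=
  let a1 := (n %/ m).+1 in let t1 := a1 %/ (n %/ c1) in let u := m * t1 - c1 in
  let* g := divs B t1 in
  [:: (a1, n %/ c2 * (g * ((s + c2 * (t1 %/ g)) %/ u)))].

Definition cand_w14 (m n B c1 c2 c3 c4 s : nat) : seq (nat * nat) :=
  let a1 := (n %/ m).+1 in let t1 := a1 %/ (n %/ c1) in let u := m * t1 - c1 in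
  let w := s * gcdn c2 c3 in
  let* p12 := divs B t1 in let* p13 := divs B t1 in let* p14 := divs B t1 in
  let* T2 := divs B t1 in let* T3 := divs B t1 in let* T4 := divs B t1 in
  let* q := divs B t1 in
  let M := p14 * w + c4 * (p12 * p13 * T4) in
  let* p24 := divs B M in let* p34 := divs B M in let* T1 := divs B M in
  let p23 := (c2 * (p13 * p34 * T2) + c3 * (p12 * p24 * T3)) %/ w in
  [:: (a1, n %/ c2 * (p12 * p23 * p24 * T1 * T3 * T4 * q))].

(** The keys up to [TA] serve the case [J >= 2], those up to [TB] the case [J = 1]. *)
Definition cand_pairs (m n B TA TB : nat) : seq (nat * nat) :=
  let* c1 := divs B n in let* c2 := divs B n in
  let* c3 := divs B n in let* c4 := divs B n in
  (let* s := iota 1 TA in cand_pT m n B c1 c2 c3 c4 s ++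
     (cand_key m n B c1 c2 c3 c4 s ++ cand_gW m n B c1 c2 c3 c4 s)) ++
  (let* s := iota 1 TB in
     (cand_pT m n B c1 c2 c3 c4 s ++ cand_pp m n B c1 c2 c3 c4 s) ++
     (cand_w12 m n B c1 c2 c3 c4 s ++ cand_w14 m n B c1 c2 c3 c4 s)).

(** For known [a1] and [a2], the equation 1/a3 + 1/a4 = m/n - 1/a1 - 1/a2 is
    [D * a3 * a4 = N * a4 + N * a3], a hyperbola with [E = 0]. *)
Definition cand_tuples (m n B TA TB : nat) : seq (4.-tuple nat) :=
  let* a := cand_pairs m n B TA TB in
  let N := n * (a.1 * a.2) in let D := m * (a.1 * a.2) - n * (a.1 + a.2) in
  let* a3 := hyperbola B D N N 0 in
  [:: [tuple a.1; a.2; a3; (N * a3 + 0) %/ (D * a3 - N)]].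

Ltac size_candidates :=
  rewrite ?expnS; do ?[apply: size_bind => [|?]; first by
    rewrite ?size_divs ?size_hyperbola]; rewrite ?expn0//.

Lemma size_cand_pT m n B c1 c2 c3 c4 s :
  size (cand_pT m n B c1 c2 c3 c4 s) <= max_divs B ^ 11.
Proof. by rewrite /cand_pT; size_candidates. Qed.

Lemma size_cand_key m n B c1 c2 c3 c4 s :
  size (cand_key m n B c1 c2 c3 c4 s) <= max_divs B ^ 10.
Proof. by rewrite /cand_key; size_candidates. Qed.

Lemma size_cand_gW m n B c1 c2 c3 c4 s :
  size (cand_gW m n B c1 c2 c3 c4 s) <= max_divs B ^ 3.
Proof. by rewrite /cand_gW; size_candidates. Qed.

Lemma size_cand_pp m n B c1 c2 c3 c4 s :
  size (cand_pp m n B c1 c2 c3 c4 s) <= max_divs B ^ 10.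
Proof. by rewrite /cand_pp; size_candidates. Qed.

Lemma size_cand_w12 m n B c1 c2 c3 c4 s :
  size (cand_w12 m n B c1 c2 c3 c4 s) <= max_divs B ^ 1.
Proof. by rewrite /cand_w12; size_candidates. Qed.

Lemma size_cand_w14 m n B c1 c2 c3 c4 s :
  size (cand_w14 m n B c1 c2 c3 c4 s) <= max_divs B ^ 10.
Proof. by rewrite /cand_w14; size_candidates. Qed.

(** The exponent 16 counts four choices of [c_i], at most eleven choices for a given key and one
    choice of [a3]. There are three kinds of keys up to [TA] and four up to [TB]. *)
Lemma size_cand_tuples (m n B TA TB : nat) :
  size (cand_tuples m n B TA TB) <= max_divs B ^ 16 * (3 * TA + 4 * TB).
Proof.
pose M := max_divs B.
have le11 k i : k <= M ^ i -> i <= 11 -> k <= M ^ 11.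
  by move=> ki i11; apply: leq_trans ki _; rewrite leq_pexp2l ?max_divs_gt0.
have -> : M ^ 16 * (3 * TA + 4 * TB) =
    M * (M * (M * (M * (TA * (3 * M ^ 11) + TB * (4 * M ^ 11))))) * (M * 1).
  by ring.
apply: size_bind => [|a]; last first.
  by apply: size_bind => [|?]; first exact: size_hyperbola.
do 4!(apply: size_bind => [|?]; first exact: size_divs).
rewrite size_cat leq_add//; apply: size_bind => [|s]; rewrite ?size_iota//.
  rewrite !size_cat 2!mulSn mul1n; do 2?apply: leq_add.
  - by apply: le11 (size_cand_pT m n B _ _ _ _ s) _.
  - by apply: le11 (size_cand_key m n B _ _ _ _ s) _.
  - by apply: le11 (size_cand_gW m n B _ _ _ _ s) _.
rewrite !size_cat (mulnDl 2 2) mul2n -addnn; apply: leq_add; apply: leq_add.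
- by apply: le11 (size_cand_pT m n B _ _ _ _ s) _.
- by apply: le11 (size_cand_pp m n B _ _ _ _ s) _.
- by apply: le11 (size_cand_w12 m n B _ _ _ _ s) _.
- by apply: le11 (size_cand_w14 m n B _ _ _ _ s) _.
Qed.

(** * The keys of one solution *)

Section Solution.

Context (m n B c1 c2 c3 c4 n1 n2 n3 n4 t1 t2 t3 t4 : nat).
Context (p12 p13 p14 p23 p24 p34 T1 T2 T3 T4 q J : nat).
Context (n_gt0 : 0 < n) (m_gt0 : 0 < m).
Context (nE1 : n = c1 * n1) (nE2 : n = c2 * n2).
Context (nE3 : n = c3 * n3) (nE4 : n = c4 * n4).
Context (t1E : t1 = p12 * p13 * p14 * T2 * T3 * T4 * q).
Context (t2E : t2 = p12 * p23 * p24 * T1 * T3 * T4 * q).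
Context (t3E : t3 = p13 * p23 * p34 * T1 * T2 * T4 * q).
Context (t4E : t4 = p14 * p24 * p34 * T1 * T2 * T3 * q).
Context (t1_gt0 : 0 < t1) (t2_gt0 : 0 < t2) (t3_gt0 : 0 < t3).
Context (cop2 : coprime c2 t2) (cop1423 : coprime p14 p23).
Context (eqx :
  m * (p12 * p13 * p14 * p23 * p24 * p34 * T1 * T2 * T3 * T4 * q) =
    c1 * (p23 * p24 * p34 * T1) + c2 * (p13 * p14 * p34 * T2) +
    c3 * (p12 * p14 * p24 * T3) + c4 * (p12 * p13 * p23 * T4)).
Context (le12 : n1 * t1 <= n2 * t2) (le23 : n2 * t2 <= n3 * t3).
Context (le34 : n3 * t3 <= n4 * t4).
Context (aJ : n1 * t1 = n %/ m + J) (J_gt0 : 0 < J).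
Context (QB : (m * n * (n1 * t1 * (n2 * t2) * (n3 * t3) * (n4 * t4))) ^ 2 <= B).

Lemma param_gt0 : (0 < p12) * (0 < p13) * (0 < p14) * (0 < p23) * (0 < p24) *
  (0 < p34) * (0 < T1) * (0 < T2) * (0 < T3) * (0 < T4) * (0 < q).
Proof.
move: t1_gt0 t2_gt0 t3_gt0; rewrite t1E t2E t3E !muln_gt0 -!andbA.
by do 3!(do 6!(case/andP=> ?); move=> ?); do !split.
Qed.

Lemma coef_gt0 : (0 < c1) * (0 < c2) * (0 < c3) * (0 < c4) *
  (0 < n1) * (0 < n2) * (0 < n3) * (0 < n4).
Proof.
move: n_gt0; rewrite {1}nE1 muln_gt0 => /andP[-> ->].
move: n_gt0; rewrite {1}nE2 muln_gt0 => /andP[-> ->].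
move: n_gt0; rewrite {1}nE3 muln_gt0 => /andP[-> ->].
by move: n_gt0; rewrite {1}nE4 muln_gt0 => /andP[-> ->].
Qed.

Lemma divn_coef : (n %/ c1 = n1) * (n %/ c2 = n2).
Proof. by split; [rewrite nE1|rewrite nE2]; rewrite mulKn// coef_gt0. Qed.

(** [u / t1 = m - c1 / t1] is the sum of the last three fractions. *)
Let u := m * t1 - c1.
Let P := m * n * (t1 * t2 * t3 * t4).

Lemma mt1E : m * t1 = u + c1.
Proof.
rewrite /u subnK//.
have k0 : 0 < p23 * p24 * p34 * T1 by rewrite !muln_gt0 !param_gt0.
rewrite -(leq_pmul2r k0); apply: leq_trans (_ : m * (p12 * p13 * p14 * p23 *
  p24 * p34 * T1 * T2 * T3 * T4 * q) <= _).
  by rewrite eqx -!addnA leq_addr.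
by apply: eq_leq; rewrite t1E; ring.
Qed.

Lemma eqx_u : u * (p23 * p24 * p34 * T1) = c2 * (p13 * p14 * p34 * T2) +
    c3 * (p12 * p14 * p24 * T3) + c4 * (p12 * p13 * p23 * T4).
Proof.
apply/eqP; rewrite -(eqn_add2l (c1 * (p23 * p24 * p34 * T1))) !addnA -eqx.
by rewrite -mulnDl addnC -mt1E t1E; apply/eqP; ring.
Qed.

Lemma u_gt0 : 0 < u.
Proof.
suff : 0 < u * (p23 * p24 * p34 * T1) by rewrite muln_gt0 => /andP[].
by rewrite eqx_u addn_gt0 !muln_gt0 !param_gt0 !coef_gt0 !orbT.
Qed.

Lemma P_gt0 : 0 < P.
Proof. by rewrite !muln_gt0 m_gt0 n_gt0 t1_gt0 t2_gt0 t3_gt0 t4E !muln_gt0 !param_gt0. Qed.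

(** As [t_i <= n_i * t_i], [P ^ 2 <= B] by [QB]. The square leaves room for [mem_hyperbola], where
    [D * x] and [D * y] are bounded by [P] separately. *)
Lemma leq_PB X Y : X <= P -> Y <= P -> X * Y <= B.
Proof.
move=> XP YP; apply: leq_trans QB; rewrite -mulnn.
have PQ : P <= m * n * (n1 * t1 * (n2 * t2) * (n3 * t3) * (n4 * t4)).
  by rewrite /P leq_mul2l !leq_mul ?orbT// leq_pmull// coef_gt0.
by apply: leq_mul; [apply: leq_trans XP PQ|apply: leq_trans YP PQ].
Qed.

Lemma leP_B X : X <= P -> X <= B.
Proof. by move=> XP; rewrite -[X]muln1; apply: leq_PB => //; exact: P_gt0. Qed.

Lemma dvdP_B X : X %| P -> X <= B.
Proof. by move=> XP; apply/leP_B/dvdn_leq => //; exact: P_gt0. Qed.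

Lemma leq_cofactor r X Y : 0 < r -> X * r = Y -> X <= Y.
Proof. by move=> r0 <-; rewrite leq_pmulr. Qed.

Lemma u_le : u <= m * t1.
Proof. exact: leq_subr. Qed.

Lemma c_dvd : (c1 %| n) * (c2 %| n) * (c3 %| n) * (c4 %| n).
Proof. by rewrite {1}nE1 {1}nE2 {1}nE3 {1}nE4 !dvdn_mulr. Qed.

Lemma n_leB : n <= B.
Proof. by apply: dvdP_B; rewrite /P; dvdn_factor. Qed.

Lemma t1_leB : t1 <= B.
Proof. by apply: dvdP_B; rewrite /P; dvdn_factor. Qed.

Ltac pos := rewrite ?(muln_gt0, addn_gt0, m_gt0, n_gt0, t1_gt0, t2_gt0, t3_gt0,
  J_gt0, u_gt0, param_gt0, coef_gt0, orbT).

Lemma mem_divs_t1 : (p12 \in divs B t1) * (p13 \in divs B t1) *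
  (p14 \in divs B t1) * (T2 \in divs B t1) * (T3 \in divs B t1) *
  (T4 \in divs B t1) * (q \in divs B t1).
Proof.
by do !split; apply: mem_divs t1_leB _ => //; rewrite t1E; dvdn_factor.
Qed.

Ltac bind_t1 :=
  apply: (mem_bind (x := p12)); first (by rewrite mem_divs_t1);
  apply: (mem_bind (x := p13)); first (by rewrite mem_divs_t1);
  apply: (mem_bind (x := p14)); first (by rewrite mem_divs_t1);
  apply: (mem_bind (x := T2)); first (by rewrite mem_divs_t1);
  apply: (mem_bind (x := T3)); first (by rewrite mem_divs_t1);
  apply: (mem_bind (x := T4)); first (by rewrite mem_divs_t1);
  apply: (mem_bind (x := q)); first (by rewrite mem_divs_t1).

Lemma leP_ut2 X : X <= u * t2 -> X <= P.
Proof.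
move/leq_trans; apply; apply: leq_trans (_ : m * t1 * t2 <= _).
  by rewrite leq_mul2r u_le orbT.
apply: (@leq_cofactor (n * (t3 * t4))); first by rewrite t4E; pos.
by rewrite /P; ring.
Qed.

Lemma leP_ut3 X : X <= u * t3 -> X <= P.
Proof.
move/leq_trans; apply; apply: leq_trans (_ : m * t1 * t3 <= _).
  by rewrite leq_mul2r u_le orbT.
apply: (@leq_cofactor (n * (t2 * t4))); first by rewrite t4E; pos.
by rewrite /P; ring.
Qed.

Lemma leP_ut4 X : X <= u * t4 -> X <= P.
Proof.
move/leq_trans; apply; apply: leq_trans (_ : m * t1 * t4 <= _).
  by rewrite leq_mul2r u_le orbT.
apply: (@leq_cofactor (n * (t2 * t3))); first by pos.
by rewrite /P; ring.
Qed.

Lemma J_le : J <= n1 * t1.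
Proof. by rewrite aJ leq_addl. Qed.

(** [J] gives [a1] and thus [t1], seven parameters are divisors of [t1], and the unknown [p24] and
    [p34] lie on the hyperbola [eqx_u]. *)
Lemma mem_cand_pT : (n1 * t1, n2 * t2) \in
  cand_pT m n B c1 c2 c3 c4 (J * (p23 * T1)).
Proof.
have sB : J * (p23 * T1) <= B.
  apply: leq_PB.
    apply: leq_trans J_le _; rewrite /P; apply: (@leq_cofactor (c1 * m * (t2 * t3 * t4))).
      by rewrite t4E; pos.
    by rewrite {1}nE1; ring.
  apply: (@leq_cofactor (m * n * (t1 * (p12 * p24 * T3 * T4 * q) * t3 * t4))).
    by rewrite t4E; pos.
  by rewrite /P t2E; ring.
have s0 : 0 < J * (p23 * T1) by pos.
have inS d : d %| J * (p23 * T1) -> d \in divs B (J * (p23 * T1)) by exact: mem_divs.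
apply: (mem_bind (inS J _)); first by dvdn_factor.
apply: (mem_bind (inS p23 _)); first by dvdn_factor.
apply: (mem_bind (inS T1 _)); first by dvdn_factor.
rewrite /= !divn_coef -aJ mulKn ?coef_gt0//.
bind_t1; apply: (mem_bind (x := p24)); last first.
  by rewrite t2E mem_seq1.
apply: (mem_hyperbola (y := p34)); rewrite ?param_gt0//.
- transitivity (u * (p23 * p24 * p34 * T1)); first by ring.
  by rewrite eqx_u; ring.
- by pos.
apply: leq_PB.
  apply: leP_ut2; rewrite t2E; apply: (@leq_cofactor (p12 * T3 * T4 * q)); first by pos.
  by ring.
apply: leP_ut3; rewrite t3E; apply: (@leq_cofactor (p13 * T2 * T4 * q)); first by pos.
by ring.
Qed.

(** Bounds partial sums of the right side of [eqx], whose left side divides [P]. *)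
Lemma leP_eqx X Y :
  X + Y = c1 * (p23 * p24 * p34 * T1) + c2 * (p13 * p14 * p34 * T2) +
    c3 * (p12 * p14 * p24 * T3) + c4 * (p12 * p13 * p23 * T4) -> X <= P.
Proof.
move=> XY; apply: (@leq_trans (X + Y)); first exact: leq_addr.
rewrite XY -eqx /P t1E t2E t3E.
apply: (@leq_cofactor (n * (t4 * (p12 * p13 * p23 * q * q * T1 * T2 * T3 * T4 * T4)))).
  by rewrite t4E; pos.
by ring.
Qed.

(** Modulo [p23], [eqx] leaves [p14] times this sum, and [p14] is coprime to [p23]. *)
Lemma p23_dvd : p23 %| c2 * (p13 * p34 * T2) + c3 * (p12 * p24 * T3).
Proof.
rewrite -(@Gauss_dvdr _ p14) ?[coprime p23 _]coprime_sym//.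
have : p23 %| m * (p12 * p13 * p14 * p23 * p24 * p34 * T1 * T2 * T3 * T4 * q).
  by dvdn_factor.
rewrite eqx dvdn_addl; last by dvdn_factor.
rewrite -addnA dvdn_addr; last by dvdn_factor.
by congr (_ %| _); ring.
Qed.

Let key := p12 * p13 * p24 * p34 * T2 * T3 * T4 * q.

(** The key fixes eight parameters, [p23] is a divisor by [p23_dvd], and [eqx] is then a hyperbola
    in [p14] and [T1]. *)
Lemma mem_cand_key : (n1 * t1, n2 * t2) \in cand_key m n B c1 c2 c3 c4 key.
Proof.
have sB : key <= B.
  apply: leP_B; apply: (@leP_eqx _ (key * (m * p14 * p23 * T1 - 1))).
  rewrite -eqx -{1}[key]muln1 -mulnDr subnKC; last by pos.
  by rewrite /key; ring.
have s0 : 0 < key by rewrite /key; pos.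
have inS d : d %| key -> d \in divs B key by exact: mem_divs.
apply: (mem_bind (inS p12 _)); first by rewrite /key; dvdn_factor.
apply: (mem_bind (inS p13 _)); first by rewrite /key; dvdn_factor.
apply: (mem_bind (inS p24 _)); first by rewrite /key; dvdn_factor.
apply: (mem_bind (inS p34 _)); first by rewrite /key; dvdn_factor.
apply: (mem_bind (inS T2 _)); first by rewrite /key; dvdn_factor.
apply: (mem_bind (inS T3 _)); first by rewrite /key; dvdn_factor.
apply: (mem_bind (inS T4 _)); first by rewrite /key; dvdn_factor.
apply: (mem_bind (inS q _)); first by rewrite /key; dvdn_factor.
have eqS : m * (p12 * p13 * p23 * p24 * p34 * T2 * T3 * T4 * q) * p14 * T1 =
  c1 * (p23 * p24 * p34) * T1 +
  (c2 * (p13 * p34 * T2) + c3 * (p12 * p24 * T3)) * p14 +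
  c4 * (p12 * p13 * p23 * T4).
  transitivity (m * (p12 * p13 * p14 * p23 * p24 * p34 * T1 * T2 * T3 * T4 * q)).
    by ring.
  by rewrite eqx; ring.
apply: (mem_bind (x := p23)).
  apply: mem_divs; first by pos.
    apply: leP_B; apply: (@leP_eqx _ (c1 * (p23 * p24 * p34 * T1) +
      c4 * (p12 * p13 * p23 * T4) +
      (c2 * (p13 * p34 * T2) + c3 * (p12 * p24 * T3)) * (p14 - 1))).
    rewrite -[p14 in RHS](subnKC (_ : 1 <= p14)); last by pos.
    by ring.
  by exact: p23_dvd.
apply: (mem_bind (x := p14)).
  apply: mem_hyperbola eqS _ _ _; [by pos|by pos|apply: leq_PB].
    apply: (@leP_eqx _ (m * (p12 * p13 * p23 * p24 * p34 * T2 * T3 * T4 * q) * p14 * (T1 - 1))).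
    rewrite -eqx -{1}[_ * p14]muln1 -mulnDr subnKC; last by pos.
    by ring.
  apply: (@leP_eqx _ (m * (p12 * p13 * p23 * p24 * p34 * T2 * T3 * T4 * q) * T1 * (p14 - 1))).
  rewrite -eqx -{1}[_ * T1]muln1 -mulnDr subnKC; last by pos.
  by ring.
rewrite (hyperbola_snd eqS); last by pos.
by rewrite !divn_coef mem_seq1 t1E t2E.
Qed.

Let g := p12 * T3 * T4 * q.
Let W := u * (p23 * p24 * T1) - c2 * (p13 * p14 * T2).

(** The subtraction in [W] is exact: after multiplication by [p34], [eqx_u] leaves the terms of [c3]
    and [c4]. *)
Lemma WE : u * (p23 * p24 * T1) = W + c2 * (p13 * p14 * T2).
Proof.
rewrite /W subnK// -(@leq_pmul2r p34) ?param_gt0//.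
have -> : u * (p23 * p24 * T1) * p34 = u * (p23 * p24 * p34 * T1) by ring.
by rewrite eqx_u -addnA; apply: leq_trans (leq_addr _ _); apply: eq_leq; ring.
Qed.

Lemma Wp34 : W * p34 = p12 * (c3 * (p14 * p24 * T3) + c4 * (p13 * p23 * T4)).
Proof.
apply/eqP; rewrite -(eqn_add2r (c2 * (p13 * p14 * T2) * p34)) -mulnDl -WE.
apply/eqP; transitivity (u * (p23 * p24 * p34 * T1)); first by ring.
by rewrite eqx_u; ring.
Qed.

Lemma W_gt0 : 0 < W.
Proof.
suff : 0 < W * p34 by rewrite muln_gt0 => /andP[].
by rewrite Wp34; pos.
Qed.

(** With [t1 = g * y1] and [t2 = g * y2], the definition of [W] reads
    [m * g * y1 * y2 = c1 * y2 + c2 * y1 + W], a hyperbola in [y1] and [y2]. *)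
Lemma mem_cand_gW : (n1 * t1, n2 * t2) \in cand_gW m n B c1 c2 c3 c4 (g * W).
Proof.
have t1g : t1 = g * (p13 * p14 * T2) by rewrite t1E /g; ring.
have t2g : t2 = g * (p23 * p24 * T1) by rewrite t2E /g; ring.
have gW : g * W <= u * t2.
  by rewrite t2g mulnCA leq_mul2l WE leq_addr orbT.
have s0 : 0 < g * W by rewrite muln_gt0 W_gt0 /g; pos.
have sB : g * W <= B by apply/leP_B/leP_ut2.
apply: (mem_bind (x := g)); first by apply: mem_divs => //; dvdn_factor.
apply: (mem_bind (x := W)); first by apply: mem_divs => //; dvdn_factor.
have eqW : m * g * (p13 * p14 * T2) * (p23 * p24 * T1) =
    c1 * (p23 * p24 * T1) + c2 * (p13 * p14 * T2) + W.
  by rewrite -[m * g * _]mulnA -t1g mt1E mulnDl WE; ring.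
apply: (mem_bind (x := p13 * p14 * T2)).
  apply: mem_hyperbola eqW _ _ _; [by pos|by pos|apply: leq_PB].
    rewrite -mulnA -t1g; apply: (@leq_cofactor (n * (t2 * t3 * t4))).
      by rewrite t4E; pos.
    by rewrite /P; ring.
  rewrite -mulnA -t2g; apply: (@leq_cofactor (n * (t1 * t3 * t4))).
    by rewrite t4E; pos.
  by rewrite /P; ring.
rewrite (hyperbola_snd eqW); last by rewrite addn_gt0 W_gt0 orbT.
by rewrite !divn_coef mem_seq1 t1g t2g.
Qed.

(** Here [t1] and its divisors are known. By [eqx_u], [p34] divides the sum of the terms of [c3] and
    [c4], which is known; then [eqx_u] is linear in [T1]. *)
Lemma mem_cand_pp : J = 1 ->
  (n1 * t1, n2 * t2) \in cand_pp m n B c1 c2 c3 c4 (p23 * p24).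
Proof.
move=> J1; have sB : p23 * p24 <= B.
  apply/leP_B/leP_ut2; rewrite t2E; apply: (@leq_cofactor (u * (p12 * T1 * T3 * T4 * q))).
    by pos.
  by ring.
apply: (mem_bind (x := p23)); first by apply: mem_divs => //; [pos|dvdn_factor].
apply: (mem_bind (x := p24)); first by apply: mem_divs => //; [pos|dvdn_factor].
rewrite /= -addn1 -J1 !divn_coef -aJ mulKn ?coef_gt0//.
bind_t1; apply: (mem_bind (x := p34)).
  apply: mem_divs; first by pos.
    apply/leP_B/(@leP_eqx _ (c1 * (p23 * p24 * p34 * T1) + c2 * (p13 * p14 * p34 * T2))).
    by ring.
  have : p34 %| u * (p23 * p24 * p34 * T1) by dvdn_factor.
  by rewrite eqx_u -addnA dvdn_addr//; dvdn_factor.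
rewrite addnA -eqx_u [u * _](_ : _ = u * (p23 * p24 * p34) * T1); last by ring.
by rewrite mulKn ?mem_seq1 ?t2E//; pos.
Qed.

(** For known [t1] and its divisor [g], [WE] is linear in [p23 * p24 * T1 = t2 / g]. *)
Lemma mem_cand_w12 : J = 1 ->
  (n1 * t1, n2 * t2) \in cand_w12 m n B c1 c2 c3 c4 W.
Proof.
move=> J1; rewrite /cand_w12 /= -addn1 -J1 !divn_coef -aJ mulKn ?coef_gt0//.
have t1g : t1 = g * (p13 * p14 * T2) by rewrite t1E /g; ring.
have t2g : t2 = g * (p23 * p24 * T1) by rewrite t2E /g; ring.
apply: (mem_bind (x := g)).
  by apply: mem_divs t1_leB _ => //; rewrite t1g; dvdn_factor.
rewrite {3}t1g mulKn; last by rewrite /g; pos.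
by rewrite -WE mulKn ?mem_seq1 ?t2g//; pos.
Qed.

Let w14 := (c2 * (p13 * p34 * T2) + c3 * (p12 * p24 * T3)) %/ p23.
Let s14 := w14 %/ gcdn c2 c3.

Lemma w14E : p23 * w14 = c2 * (p13 * p34 * T2) + c3 * (p12 * p24 * T3).
Proof. by rewrite mulnC divnK ?p23_dvd. Qed.

(** [gcdn c2 c3] divides [p23 * w14], and it is coprime to [p23], a factor of [t2]. *)
Lemma s14E : s14 * gcdn c2 c3 = w14.
Proof.
rewrite divnK// -(@Gauss_dvdr _ p23).
  rewrite w14E dvdn_add// dvdn_mulr ?dvdn_gcdl ?dvdn_gcdr//.
by apply: coprime_factors cop2 (dvdn_gcdl _ _) _; rewrite t2E; dvdn_factor.
Qed.

Lemma w14_gt0 : 0 < w14.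
Proof.
suff : 0 < p23 * w14 by rewrite muln_gt0 => /andP[].
by rewrite w14E; pos.
Qed.

(** The known number [p14 * w14 + c4 * (p12 * p13 * T4)] equals [u * (p24 * p34 * T1)], so [p24],
    [p34] and [T1] are among its divisors, and [w14E] yields [p23]. *)
Lemma mem_cand_w14 : J = 1 ->
  (n1 * t1, n2 * t2) \in cand_w14 m n B c1 c2 c3 c4 s14.
Proof.
move=> J1; rewrite /cand_w14 /= -addn1 -J1 !divn_coef -aJ mulKn ?coef_gt0//.
rewrite s14E; bind_t1.
have -> : p14 * w14 + c4 * (p12 * p13 * T4) = u * (p24 * p34 * T1).
  apply/eqP; rewrite -(@eqn_pmul2l p23) ?param_gt0// mulnDr mulnCA w14E.
  apply/eqP; transitivity (u * (p23 * p24 * p34 * T1)); last by ring.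
  by rewrite eqx_u; ring.
have MB : u * (p24 * p34 * T1) <= B.
  apply/leP_B/leP_ut4; apply: (@leq_cofactor (p14 * T2 * T3 * q)); first by pos.
  by rewrite t4E; ring.
have M0 : 0 < u * (p24 * p34 * T1) by pos.
apply: (mem_bind (x := p24)); first by apply: mem_divs => //; dvdn_factor.
apply: (mem_bind (x := p34)); first by apply: mem_divs => //; dvdn_factor.
apply: (mem_bind (x := T1)); first by apply: mem_divs => //; dvdn_factor.
by rewrite -w14E mulnK ?w14_gt0// mem_seq1 t2E.
Qed.

(** * Size of the products of keys *)

Lemma coef_le : (c4 * (p13 * p23 * T4) <= c3 * (p14 * p24 * T3) /\
  c3 * (p12 * p24 * T3) <= c2 * (p13 * p34 * T2)) /\
  c2 * (p13 * p14 * T2) <= c1 * (p23 * p24 * T1).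
Proof.
(* As [k = n / c], the order of the denominators [k * t] is the reverse order of the fractions
   [c / t]; parameters common to both sides are cancelled below. *)
have aux c c' k k' t t' : n = c * k -> n = c' * k' -> 0 < k -> 0 < k' ->
    k * t <= k' * t' -> c' * t <= c * t'.
  move=> ck ck' k0 k'0 tt'; rewrite -(@leq_pmul2l (k * k')) ?muln_gt0 ?k0//.
  have -> : k * k' * (c' * t) = c' * k' * (k * t) by ring.
  have -> : k * k' * (c * t') = c * k * (k' * t') by ring.
  by rewrite -ck -ck' leq_mul2l tt' orbT.
split; last first.
  have := aux _ _ _ _ _ _ nE1 nE2; rewrite !coef_gt0 => /(_ _ _ isT isT le12).
  rewrite t1E t2E -[in X in _ -> X](@leq_pmul2l (p12 * T3 * T4 * q)); last by pos.
  by congr (_ <= _); ring.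
split.
  have := aux _ _ _ _ _ _ nE3 nE4; rewrite !coef_gt0 => /(_ _ _ isT isT le34).
  rewrite t3E t4E -[in X in _ -> X](@leq_pmul2l (p34 * T1 * T2 * q)); last by pos.
  by congr (_ <= _); ring.
have := aux _ _ _ _ _ _ nE2 nE3; rewrite !coef_gt0 => /(_ _ _ isT isT le23).
rewrite t2E t3E -[in X in _ -> X](@leq_pmul2l (p23 * T1 * T4 * q)); last by pos.
by congr (_ <= _); ring.
Qed.

(** The factor [p34] of [key] is paired with [W]: by [Wp34], [W * p34] is a sum of two terms, the
    larger being that of [c3 <= n]. *)
Lemma prod_keys : (J * (p23 * T1)) ^ 2 * key * (g * W) <= 2 * n * J ^ 2 * t1 * t2 ^ 2.
Proof.
have c3n : c3 <= n by rewrite dvdn_leq// c_dvd.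
have Wle : W * p34 <= 2 * n * (p12 * p14 * p24 * T3).
  rewrite Wp34; apply: leq_trans (_ : p12 * (2 * (c3 * (p14 * p24 * T3))) <= _).
    by rewrite leq_mul2l mul2n -addnn leq_add2l coef_le.1.1 orbT.
  rewrite [leqRHS](_ : _ = p12 * (2 * (n * (p14 * p24 * T3)))); last by ring.
  by rewrite !leq_mul2l leq_mul2r c3n !orbT.
pose K := (J * (p23 * T1)) ^ 2 * (p12 * p13 * p24 * T2 * T3 * T4 * q) * g.
have -> : (J * (p23 * T1)) ^ 2 * key * (g * W) = K * (W * p34).
  by rewrite /K /key; ring.
apply: (@leq_trans (K * (2 * n * (p12 * p14 * p24 * T3)))).
  by rewrite leq_mul2l Wle orbT.
apply: (@leq_cofactor (T4 * q)); first by pos.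
by rewrite /K /g t1E t2E; ring.
Qed.

(** The bounds for [W * p34] and [p23 * w14] bring in [c3] and [c2]. The division of [w14] by the
    gcd turns their product into [lcmn c2 c3], which divides [n], so that only one factor [n] is
    lost. *)
Lemma prod_keys1 : (p23 * T1) ^ 2 * (p23 * p24) * W * s14 <=
  4 * n * t1 * t2 ^ 2.
Proof.
have h0 : 0 < gcdn c2 c3 by rewrite gcdn_gt0 coef_gt0.
have c23 : c2 * c3 <= n * gcdn c2 c3.
  rewrite -muln_lcm_gcd leq_mul2r dvdn_leq ?orbT//.
  by rewrite dvdn_lcm !c_dvd.
have Wle : W * p34 <= 2 * c3 * (p12 * p14 * p24 * T3).
  rewrite Wp34; apply: leq_trans (_ : p12 * (2 * (c3 * (p14 * p24 * T3))) <= _).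
    by rewrite leq_mul2l mul2n -addnn leq_add2l coef_le.1.1 orbT.
  by apply: eq_leq; ring.
have wle : p23 * w14 <= 2 * c2 * (p13 * p34 * T2).
  by rewrite w14E -(mulnA 2) mul2n -addnn leq_add2l coef_le.1.2.
rewrite -(@leq_pmul2r (gcdn c2 c3 * p34 * p23)); last by rewrite !muln_gt0 h0 !param_gt0.
apply: leq_trans (_ : (p23 * T1) ^ 2 * (p23 * p24) *
  (2 * c3 * (p12 * p14 * p24 * T3) * (2 * c2 * (p13 * p34 * T2))) <= _).
  have -> : (p23 * T1) ^ 2 * (p23 * p24) * W * s14 * (gcdn c2 c3 * p34 * p23) =
      (p23 * T1) ^ 2 * (p23 * p24) * (W * p34 * (p23 * w14)).
    by rewrite -s14E; ring.
  by rewrite leq_mul2l leq_mul ?orbT.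
have -> : (p23 * T1) ^ 2 * (p23 * p24) *
    (2 * c3 * (p12 * p14 * p24 * T3) * (2 * c2 * (p13 * p34 * T2))) =
    4 * (p23 * T1) ^ 2 * (p23 * p24) * (p12 * p14 * p24 * T3) *
    (p13 * p34 * T2) * (c2 * c3) by ring.
apply: leq_trans (leq_mul (leqnn _) c23) _.
apply: (@leq_cofactor (p12 ^ 2 * T3 ^ 2 * T4 ^ 3 * q ^ 3)).
  by rewrite !(muln_gt0, expn_gt0) !param_gt0.
by rewrite t1E t2E; ring.
Qed.

(** [u / t1] is the sum of three fractions, the largest being [c2 / t2]. *)
Lemma leq_ut2 : u * t2 <= 3 * c2 * t1.
Proof.
have [[c43 c32] _] := coef_le.
rewrite t1E t2E -(@leq_pmul2r p34) ?param_gt0//.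
have -> : u * (p12 * p23 * p24 * T1 * T3 * T4 * q) * p34 =
  u * (p23 * p24 * p34 * T1) * (p12 * T3 * T4 * q) by ring.
have -> : 3 * c2 * (p12 * p13 * p14 * T2 * T3 * T4 * q) * p34 =
  3 * (p14 * (c2 * (p13 * p34 * T2))) * (p12 * T3 * T4 * q) by ring.
rewrite eqx_u leq_mul2r; apply/orP; right.
have c3le : c3 * (p12 * p14 * p24 * T3) <= p14 * (c2 * (p13 * p34 * T2)).
  by rewrite (_ : c3 * _ = p14 * (c3 * (p12 * p24 * T3))) ?leq_mul2l ?c32 ?orbT//; ring.
have c4le : c4 * (p12 * p13 * p23 * T4) <= c3 * (p12 * p14 * p24 * T3).
  rewrite (_ : c4 * _ = p12 * (c4 * (p13 * p23 * T4))); last by ring.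
  rewrite (_ : c3 * _ = p12 * (c3 * (p14 * p24 * T3))); last by ring.
  by rewrite leq_mul2l c43 orbT.
rewrite (_ : c2 * _ = p14 * (c2 * (p13 * p34 * T2))); last by ring.
move: c3le c4le; move: (p14 * _) (c3 * _) (c4 * _); clear => X Y Z; lia.
Qed.

Lemma leq_ma1 : m * (n1 * t1) <= 4 * n.
Proof.
have [_ c21] := coef_le.
rewrite mulnCA nE1 [4 * _](_ : _ = n1 * (4 * c1)); last by ring.
rewrite leq_mul2l; apply/orP; right; rewrite mt1E (_ : 4 * c1 = 3 * c1 + c1); last by ring.
rewrite leq_add2r -(@leq_pmul2r t2)//; apply: leq_trans leq_ut2 _.
rewrite t1E t2E (_ : _ * _ * _ = 3 * (c2 * (p13 * p14 * T2)) * (p12 * T3 * T4 * q)); last by ring.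
apply: (@leq_trans (3 * (c1 * (p23 * p24 * T1)) * (p12 * T3 * T4 * q))).
  by rewrite leq_mul2r leq_mul2l c21 !orbT.
by apply: eq_leq; ring.
Qed.

(** [n1 * u = m * J - n %% m], and the remainder is below [m], which is at most half of [m * J] when
    [J >= 2]. *)
Lemma leq_mJ : 1 < J -> m * J <= 2 * (n1 * u).
Proof.
move=> J1; have mE : n1 * u + n = m * (n %/ m) + m * J.
  by rewrite {1}nE1 mulnC [c1 * _]mulnC (mulnC u) -mulnDr -mt1E mulnCA aJ mulnDr.
have nE := divn_eq n m; have rm : n %% m < m by rewrite ltn_mod.
have m2 : m * 2 <= m * J by rewrite leq_mul2l J1 orbT.
move: mE nE rm m2; rewrite [n %/ m * m]mulnC.
move: (m * (n %/ m)) (n1 * u) (n %% m) (m * J); clear => X Y r Z; lia.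
Qed.

(** [leq_mJ] and [leq_ut2] give [m * J * t2 <= 6 * n * a1] for [a1 = n1 * t1]; with
    [m * a1 <= 4 * n] the constant is [2 * 6 ^ 2 * 4 ^ 3 = 4608]. *)
Lemma prod_keys_le : 1 < J ->
  (J * (p23 * T1)) ^ 2 * key * (g * W) * m ^ 5 <= 4608 * n ^ 6.
Proof.
move=> J1; apply: leq_trans (leq_mul prod_keys (leqnn _)) _.
have mJt2 : m * J * t2 <= 6 * n * (n1 * t1).
  apply: leq_trans (leq_mul (leq_mJ J1) (leqnn _)) _.
  rewrite (_ : 2 * (n1 * u) * t2 = 2 * n1 * (u * t2)); last by ring.
  apply: leq_trans (leq_mul (leqnn _) leq_ut2) _.
  rewrite (_ : _ * _ = 6 * (n1 * t1) * c2); last by ring.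
  rewrite (_ : 6 * n * _ = 6 * (n1 * t1) * n); last by ring.
  by rewrite leq_mul2l dvdn_leq ?orbT// c_dvd.
have t1a1 : t1 <= n1 * t1 by rewrite leq_pmull// coef_gt0.
rewrite (_ : 2 * n * J ^ 2 * t1 * t2 ^ 2 * m ^ 5 =
  2 * n * m ^ 3 * t1 * (m * J * t2) ^ 2); last by ring.
apply: (@leq_trans (2 * n * m ^ 3 * (n1 * t1) * (6 * n * (n1 * t1)) ^ 2)).
  by rewrite leq_mul ?leq_mul2l ?t1a1 ?orbT// leq_sqr.
rewrite (_ : _ * _ = 72 * n ^ 3 * (m * (n1 * t1)) ^ 3); last by ring.
rewrite (_ : 4608 * n ^ 6 = 72 * n ^ 3 * (4 * n) ^ 3); last by ring.
by rewrite leq_mul2l leq_exp2r ?leq_ma1 ?orbT.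
Qed.

(** Here [t2] is bounded through [u >= 1] alone, by [3 * n * a1], so only [m ^ 3] is gained. The
    constant is [4 * 3 ^ 2 * 4 ^ 3 = 2304]. *)
Lemma prod_keys1_le :
  (p23 * T1) ^ 2 * (p23 * p24) * W * s14 * m ^ 3 <= 2304 * n ^ 6.
Proof.
apply: leq_trans (leq_mul prod_keys1 (leqnn _)) _.
have t2le : t2 <= 3 * n * (n1 * t1).
  apply: leq_trans (leq_pmull t2 u_gt0) _; apply: leq_trans leq_ut2 _.
  rewrite -mulnA -[leqRHS]mulnA leq_mul2l; apply: leq_mul; first by rewrite dvdn_leq// c_dvd.
  by rewrite leq_pmull// coef_gt0.
have t1a1 : t1 <= n1 * t1 by rewrite leq_pmull// coef_gt0.
rewrite (_ : _ * m ^ 3 = 4 * n * m ^ 3 * t1 * t2 ^ 2); last by ring.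
apply: (@leq_trans (4 * n * m ^ 3 * (n1 * t1) * (3 * n * (n1 * t1)) ^ 2)).
  by rewrite leq_mul ?leq_mul2l ?t1a1 ?orbT// leq_sqr.
rewrite (_ : _ * _ = 36 * n ^ 3 * (m * (n1 * t1)) ^ 3); last by ring.
rewrite (_ : 2304 * n ^ 6 = 36 * n ^ 3 * (4 * n) ^ 3); last by ring.
by rewrite leq_mul2l leq_exp2r ?leq_ma1 ?orbT.
Qed.

(** If all keys exceeded the threshold, their weighted product would be at least [TA.+1 ^ 4]
    (weights 2, 1, 1) or [TB.+1 ^ 5] (weights 2, 1, 1, 1), against [prod_keys_le] or
    [prod_keys1_le]. *)
Lemma mem_cand_pairs (TA TB : nat) :
  4608 * n ^ 6 < TA.+1 ^ 4 * m ^ 5 -> 2304 * n ^ 6 < TB.+1 ^ 5 * m ^ 3 ->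
  (n1 * t1, n2 * t2) \in cand_pairs m n B TA TB.
Proof.
move=> hA hB.
have inn c : c %| n -> c \in divs B n by move=> cn; apply: mem_divs n_leB _.
apply: (mem_bind (inn c1 _)); first by rewrite c_dvd.
apply: (mem_bind (inn c2 _)); first by rewrite c_dvd.
apply: (mem_bind (inn c3 _)); first by rewrite c_dvd.
apply: (mem_bind (inn c4 _)); first by rewrite c_dvd.
rewrite mem_cat; move: J_gt0; rewrite leq_eqVlt => /predU1P[J1|J1].
  apply/orP; right.
  have [F_le|F_gt] := leqP (p23 * T1) TB.
    apply: (mem_bind (x := J * (p23 * T1))); last by rewrite !mem_cat mem_cand_pT.
    by rewrite -J1 mul1n mem_iota add1n ltnS F_le andbT; pos.
  have [P_le|P_gt] := leqP (p23 * p24) TB.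
    apply: (mem_bind (x := p23 * p24)); last by rewrite !mem_cat mem_cand_pp ?orbT.
    by rewrite mem_iota add1n ltnS P_le andbT; pos.
  have [W_le|Wgt] := leqP W TB.
    apply: (mem_bind (x := W)); last by rewrite !mem_cat mem_cand_w12 ?orbT.
    by rewrite mem_iota add1n ltnS W_le andbT W_gt0.
  have [s_le|s_gt] := leqP s14 TB.
    apply: (mem_bind (x := s14)); last by rewrite !mem_cat mem_cand_w14 ?orbT.
    rewrite mem_iota add1n ltnS s_le andbT.
    by move: w14_gt0; rewrite -s14E muln_gt0 => /andP[].
  move: hB; rewrite ltnNge => /negP[]; apply: leq_trans prod_keys1_le.
  rewrite leq_mul2r (_ : TB.+1 ^ 5 = TB.+1 ^ 2 * TB.+1 * TB.+1 * TB.+1); last by ring.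
  by rewrite !leq_mul ?orbT// leq_sqr.
apply/orP; left.
have [F_le|F_gt] := leqP (J * (p23 * T1)) TA.
  apply: (mem_bind (x := J * (p23 * T1))); last by rewrite !mem_cat mem_cand_pT.
  by rewrite mem_iota add1n ltnS F_le andbT; pos.
have [S_le|S_gt] := leqP key TA.
  apply: (mem_bind (x := key)); last by rewrite !mem_cat mem_cand_key ?orbT.
  by rewrite mem_iota add1n ltnS S_le andbT /key; pos.
have [W_le|Wgt] := leqP (g * W) TA.
  apply: (mem_bind (x := g * W)); last by rewrite !mem_cat mem_cand_gW ?orbT.
  by rewrite mem_iota add1n ltnS W_le andbT muln_gt0 W_gt0 /g; pos.
move: hA; rewrite ltnNge => /negP[]; apply: leq_trans (prod_keys_le J1).
rewrite leq_mul2r (_ : TA.+1 ^ 4 = TA.+1 ^ 2 * TA.+1 * TA.+1); last by ring.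
by rewrite !leq_mul ?orbT// leq_sqr.
Qed.
End Solution.

(** * Every solution is a candidate *)

Lemma four_unit_fractions_prod_le (m n a1 a2 a3 a4 : nat) :
  0 < m -> 0 < n -> 0 < a1 -> a1 <= a2 -> a2 <= a3 -> a3 <= a4 ->
  m * (a1 * a2 * a3 * a4) = n * (a2 * a3 * a4) + n * (a1 * a3 * a4) +
    n * (a1 * a2 * a4) + n * (a1 * a2 * a3) ->
  m * n * (a1 * a2 * a3 * a4) <= (5 * n) ^ 17.
Proof.
move=> m0 n0 a1_0 le12 le23 le34 E.
have a2_0 : 0 < a2 by exact: leq_trans le12.
have a3_0 : 0 < a3 by exact: leq_trans le23.
have a4_0 : 0 < a4 by exact: leq_trans le34.
have le4 : m * a1 <= 4 * n.
  rewrite -(@leq_pmul2r (a2 * a3 * a4)) ?muln_gt0 ?a2_0 ?a3_0//.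
  rewrite (_ : m * a1 * _ = m * (a1 * a2 * a3 * a4)); last by ring.
  rewrite E (_ : 4 * n * _ = n * (a2 * a3 * a4) + n * (a2 * a3 * a4) +
    n * (a2 * a3 * a4) + n * (a2 * a3 * a4)); last by ring.
  rewrite -!addnA leq_add2l !leq_add// leq_mul2l; apply/orP; right.
  - by rewrite -!mulnA leq_mul2r le12 orbT.
  - rewrite !leq_mul2r; apply/orP; right.
    by apply: leq_mul => //; apply: leq_trans le23.
  - apply: leq_trans (_ : a2 * a3 * a3 <= _); last by rewrite leq_mul2l le34 orbT.
    by rewrite leq_mul2r leq_mul ?orbT.
have gt1 : n < m * a1.
  rewrite -(@ltn_pmul2r (a2 * a3 * a4)) ?muln_gt0 ?a2_0 ?a3_0//.
  rewrite (_ : m * a1 * _ = m * (a1 * a2 * a3 * a4)); last by ring.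
  rewrite E -!addnA -[X in X < _]addn0 ltn_add2l.
  by rewrite !(addn_gt0, muln_gt0) n0 a1_0 a3_0 a4_0.
(* The remainder after [1 / a1] has numerator [m * a1 - n >= 1] over [n * a1], and is at most
   [3 / a2]. *)
have a2_le : a2 <= 3 * (n * a1).
  rewrite -(@leq_pmul2r (a3 * a4)) ?muln_gt0 ?a3_0//.
  apply: leq_trans (_ : (m * a1 - n) * (a2 * (a3 * a4)) <= _).
    by rewrite leq_pmull// subn_gt0.
  rewrite mulnBl leq_subLR (_ : m * a1 * _ = m * (a1 * a2 * a3 * a4)); last by ring.
  rewrite E (_ : 3 * _ * _ = n * (a1 * a3 * a4) + n * (a1 * a3 * a4) +
    n * (a1 * a3 * a4)); last by ring.
  rewrite (_ : n * (a2 * _) = n * (a2 * a3 * a4)); last by ring.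
  rewrite -!addnA !leq_add2l leq_add// leq_mul2l; apply/orP; right.
    by rewrite leq_mul2r leq_mul2l le23 !orbT.
  rewrite -!mulnA leq_mul2l; apply/orP; right.
  by rewrite mulnC leq_mul2l (leq_trans le23 le34) orbT.
pose N := n * (a1 * a2); pose D := m * (a1 * a2) - n * (a1 + a2).
have gt2 : n * (a1 + a2) < m * (a1 * a2).
  rewrite -(@ltn_pmul2r (a3 * a4)) ?muln_gt0 ?a3_0//.
  rewrite (_ : m * _ * _ = m * (a1 * a2 * a3 * a4)); last by ring.
  rewrite E (_ : n * _ * _ = n * (a2 * a3 * a4) + n * (a1 * a3 * a4)); last by ring.
  rewrite -addnA -[X in X < _]addn0 ltn_add2l.
  by rewrite !(addn_gt0, muln_gt0) n0 a1_0 a2_0 a4_0.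
have D0 : 0 < D by rewrite subn_gt0.
have DE : D * a3 * a4 = N * a4 + N * a3.
  rewrite /D /N -mulnA mulnBl (_ : m * _ * _ = m * (a1 * a2 * a3 * a4)); last by ring.
  rewrite E (_ : n * _ * _ = n * (a2 * a3 * a4) + n * (a1 * a3 * a4)); last by ring.
  by rewrite -addnA addKn; ring.
have a3_le : a3 <= 2 * N.
  rewrite -(@leq_pmul2r a4)//; apply: leq_trans (leq_pmull (a3 * a4) D0) _.
  by rewrite mulnA DE mul2n -addnn mulnDl leq_add2l leq_mul2l le34 orbT.
(* [N * a3 = a4 * (D * a3 - N)], with a positive second factor. *)
have a4_le : a4 <= N * a3.
  have gt3 : N < D * a3.
    rewrite -(@ltn_pmul2r a4)// DE -[X in X < _]addn0 ltn_add2l.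
    by rewrite /N !muln_gt0 n0 a1_0 a2_0.
  rewrite -(@leq_add2r (N * a4)) [N * a3 + _]addnC -DE -mulSn.
  by rewrite leq_mul2r gt3 orbT.
have n5 : n <= 5 * n by rewrite leq_pmull.
have m_le : m <= 5 * n.
  apply: leq_trans (_ : 4 * n <= _); last by rewrite leq_mul2r orbT.
  by apply: leq_trans le4; rewrite leq_pmulr.
have a1_le : a1 <= 5 * n.
  apply: leq_trans (_ : 4 * n <= _); last by rewrite leq_mul2r orbT.
  by apply: leq_trans le4; rewrite leq_pmull.
have a1n4 : a1 <= 4 * n by apply: leq_trans le4; rewrite leq_pmull.
have {}a2_le : a2 <= (5 * n) ^ 2.
  apply: leq_trans a2_le _; apply: leq_trans (_ : 3 * (n * (4 * n)) <= _).
    by rewrite !leq_mul2l a1n4 !orbT.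
  rewrite (_ : 3 * _ = 12 * n ^ 2); last by ring.
  by rewrite expnMn leq_mul2r orbT.
have N_le : 2 * N <= (5 * n) ^ 4.
  apply: (@leq_trans ((5 * n) * (5 * n) * (5 * n) ^ 2)); last by apply: eq_leq; ring.
  rewrite (_ : 2 * N = (2 * n) * a1 * a2); last by rewrite /N; ring.
  by rewrite !leq_mul// leq_mul2r orbT.
have {}a3_le := leq_trans a3_le N_le.
have {}a4_le : a4 <= (5 * n) ^ 8.
  apply: leq_trans a4_le _; rewrite (_ : (5 * n) ^ 8 = (5 * n) ^ 4 * (5 * n) ^ 4); last by ring.
  by apply: leq_mul => //; apply: leq_trans N_le; rewrite leq_pmull.
(* The exponents are 1 for each of [m], [n], [a1], and 2, 4, 8 for [a2], [a3], [a4]. *)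
rewrite (_ : (5 * n) ^ 17 = (5 * n) * (5 * n) *
  ((5 * n) * (5 * n) ^ 2 * (5 * n) ^ 4 * (5 * n) ^ 8)); last by ring.
by rewrite !leq_mul.
Qed.

Lemma mem_cand_tuples (m n TA TB a1 a2 a3 a4 : nat) :
  0 < m -> 0 < n -> 0 < a1 -> a1 <= a2 -> a2 <= a3 -> a3 <= a4 ->
  m * (a1 * a2 * a3 * a4) = n * (a2 * a3 * a4) + n * (a1 * a3 * a4) +
    n * (a1 * a2 * a4) + n * (a1 * a2 * a3) ->
  4608 * n ^ 6 < TA.+1 ^ 4 * m ^ 5 -> 2304 * n ^ 6 < TB.+1 ^ 5 * m ^ 3 ->
  [tuple a1; a2; a3; a4] \in cand_tuples m n (((5 * n) ^ 17) ^ 2) TA TB.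
Proof.
move=> m0 n0 a1_0 le12 le23 le34 E hA hB.
have a2_0 : 0 < a2 by exact: leq_trans le12.
have a3_0 : 0 < a3 by exact: leq_trans le23.
have a4_0 : 0 < a4 by exact: leq_trans le34.
have Q := four_unit_fractions_prod_le m0 n0 a1_0 le12 le23 le34 E.
set B := (_ ^ 2); have QB : (m * n * (a1 * a2 * a3 * a4)) ^ 2 <= B by rewrite leq_sqr.
apply: (mem_bind (x := (a1, a2))); last first.
  have E4 : (m * (a1 * a2) - n * (a1 + a2)) * a3 * a4 =
      n * (a1 * a2) * a4 + n * (a1 * a2) * a3 + 0.
    rewrite addn0 -mulnA mulnBl (_ : m * _ * _ = m * (a1 * a2 * a3 * a4)); last by ring.
    rewrite E (_ : n * _ * _ = n * (a2 * a3 * a4) + n * (a1 * a3 * a4)); last by ring.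
    by rewrite -addnA addKn; ring.
  apply: (mem_bind (x := a3)).
    apply: mem_hyperbola E4 _ _ _ => //=.
      by rewrite addn_gt0 !muln_gt0 n0 a1_0 a2_0.
    apply: leq_trans QB; rewrite -mulnn.
    apply: leq_trans (_ : m * (a1 * a2) * a3 * (m * (a1 * a2) * a4) <= _).
      by apply: leq_mul; rewrite leq_mul2r leq_subr orbT.
    apply: leq_mul.
      apply: (@leq_trans (m * (a1 * a2) * a3 * (n * a4))); last by apply: eq_leq; ring.
      by rewrite leq_pmulr// muln_gt0 n0.
    apply: (@leq_trans (m * (a1 * a2) * a4 * (n * a3))); last by apply: eq_leq; ring.
    by rewrite leq_pmulr// muln_gt0 n0.
  rewrite /= (hyperbola_snd E4) ?mem_seq1//.
  by rewrite addn_gt0 !muln_gt0 n0 a1_0 a2_0 a3_0.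
(* [1 / a1 < m / n] puts [a1] strictly above [n %/ m], whence [J >= 1]. *)
have gt1 : n %/ m < a1.
  rewrite ltn_divLR// -(@ltn_pmul2r (a2 * a3 * a4)) ?muln_gt0 ?a2_0 ?a3_0//.
  rewrite (_ : a1 * m * _ = m * (a1 * a2 * a3 * a4)); last by ring.
  rewrite E -!addnA -[X in X < _]addn0 ltn_add2l.
  by rewrite !(addn_gt0, muln_gt0) n0 a1_0 a3_0 a4_0.
have aJ : a1 = n %/ m + (a1 - n %/ m) by rewrite subnKC// ltnW.
have J0 : 0 < a1 - n %/ m by rewrite subn_gt0.
move: (a1 - n %/ m) aJ J0 => J aJ J0 {gt1}.
(* The reduced form of [n / a_i] is [c_i / t_i]; these four fractions add up to [m]. *)
have [n1 [t1 [c1 [a1E nE1 cop1]]]] := gcd_split2 a1_0 n0.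
have [n2 [t2 [c2 [a2E nE2 cop2]]]] := gcd_split2 a2_0 n0.
have [n3 [t3 [c3 [a3E nE3 cop3]]]] := gcd_split2 a3_0 n0.
have [n4 [t4 [c4 [a4E nE4 cop4]]]] := gcd_split2 a4_0 n0.
have [n1_0 t1_0] : 0 < n1 /\ 0 < t1 by apply/andP; rewrite -muln_gt0 -a1E.
have [n2_0 t2_0] : 0 < n2 /\ 0 < t2 by apply/andP; rewrite -muln_gt0 -a2E.
have [n3_0 t3_0] : 0 < n3 /\ 0 < t3 by apply/andP; rewrite -muln_gt0 -a3E.
have [n4_0 t4_0] : 0 < n4 /\ 0 < t4 by apply/andP; rewrite -muln_gt0 -a4E.
rewrite coprime_sym in cop1; rewrite coprime_sym in cop2.
rewrite coprime_sym in cop3; rewrite coprime_sym in cop4.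
have Et : m * (t1 * t2 * t3 * t4) = c1 * (t2 * t3 * t4) + c2 * (t1 * t3 * t4) +
    c3 * (t1 * t2 * t4) + c4 * (t1 * t2 * t3).
  apply/eqP; rewrite -(@eqn_pmul2l (n1 * n2 * n3 * n4)) ?muln_gt0 ?n1_0 ?n2_0 ?n3_0//.
  apply/eqP; transitivity (m * (a1 * a2 * a3 * a4)).
    by rewrite a1E a2E a3E a4E; ring.
  rewrite E {1}nE1 {1}nE2 {1}nE3 {1}nE4 a1E a2E a3E a4E; ring.
have [p12 [p13 [p14 [p23 [p24 [p34 [T1 [T2 [T3 [T4 [q]]]]]]]]]]] :=
  four_fraction_param t1_0 t2_0 t3_0 t4_0 cop1 cop2 cop3 cop4 Et.
move=> [[t1E t2E t3E t4E] cop1423 eqx].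
rewrite [n1 * c1]mulnC in nE1; rewrite [n2 * c2]mulnC in nE2.
rewrite [n3 * c3]mulnC in nE3; rewrite [n4 * c4]mulnC in nE4.
move: le12 le23 le34 aJ QB; rewrite a1E a2E a3E a4E => le12 le23 le34 aJ QB.
exact: (mem_cand_pairs n0 m0 nE1 nE2 nE3 nE4 t1E t2E t3E t4E t1_0 t2_0 t3_0
  cop2 cop1423 eqx le12 le23 le34 aJ J0 QB hA hB).
Qed.

Local Open Scope ring_scope.

(** * Real estimates *)

Lemma egyptian_reps4 (m n : nat) (a : 4.-tuple nat) : (0 < n)%N ->
  egyptian_reps 4 (m%:R / n%:R) a ->
  exists a1 a2 a3 a4 : nat, [/\ a = [tuple a1; a2; a3; a4], (0 < a1)%N,
    (a1 <= a2)%N && (a2 <= a3 <= a4)%N &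
    (m * (a1 * a2 * a3 * a4) = n * (a2 * a3 * a4) + n * (a1 * a3 * a4) +
       n * (a1 * a2 * a4) + n * (a1 * a2 * a3))%N].
Proof.
move=> n0.
case/tupleP: a => a1 a; case/tupleP: a => a2 a; case/tupleP: a => a3 a.
case/tupleP: a => a4 a; rewrite (tuple0 a) => -[pos mono].
rewrite !big_ord_recl big_ord0 addr0 !(tnth_nth 0%N) /=.
have a1_0 : (0 < a1)%N := pos ord0.
have a2_0 : (0 < a2)%N := pos (@Ordinal 4 1 isT).
have a3_0 : (0 < a3)%N := pos (@Ordinal 4 2 isT).
have a4_0 : (0 < a4)%N := pos (@Ordinal 4 3 isT).
have le12 : (a1 <= a2)%N := mono ord0 (@Ordinal 4 1 isT) isT.
have le23 : (a2 <= a3)%N := mono (@Ordinal 4 1 isT) (@Ordinal 4 2 isT) isT.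
have le34 : (a3 <= a4)%N := mono (@Ordinal 4 2 isT) (@Ordinal 4 3 isT) isT.
move=> E; exists a1, a2, a3, a4; split; rewrite ?le12 ?le23 ?le34//.
apply/eqP; rewrite -(eqr_nat rat) !(natrD, natrM); apply/eqP.
have nz k : (0 < k)%N -> (k%:R : rat) != 0 by rewrite pnatr_eq0 -lt0n.
have -> : m%:R = (m%:R / n%:R) * n%:R :> rat by rewrite divfK ?nz.
rewrite E; field; rewrite !nz//.
Qed.

Lemma f4_le (m n TA TB : nat) : (0 < m)%N -> (0 < n)%N ->
  (4608 * n ^ 6 < TA.+1 ^ 4 * m ^ 5)%N -> (2304 * n ^ 6 < TB.+1 ^ 5 * m ^ 3)%N ->
  (f 4 m n <= max_divs (((5 * n) ^ 17) ^ 2) ^ 16 * (3 * TA + 4 * TB))%N.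
Proof.
move=> m0 n0 hA hB; apply: leq_trans (size_cand_tuples m n _ TA TB).
apply: leq_trans (size_undup _); rewrite -(size_seq_fset tt).
apply/fsubset_leq_card/fsubsetP => a.
rewrite in_fset_set; last exact: finite_egyptian_reps.
rewrite inE => /(egyptian_reps4 n0)[a1 [a2 [a3 [a4 [-> a1_0 /and3P[le12 le23 le34] E]]]]].
by rewrite seq_fsetE; exact: (mem_cand_tuples m0 n0 a1_0 le12 le23 le34 E hA hB).
Qed.

Lemma max_divs_le (r : nat) : (0 < r)%N ->
  exists2 C, (0 < C)%N & forall B, (0 < B)%N -> (max_divs B ^ r <= C * B)%N.
Proof.
move=> r0; have [C C0 HC] := size_divisors_bound r0; exists C => // B B0.
rewrite /max_divs; have [|k ->] := @bigop.eq_bigmax 'I_B.+1 (fun k => size (divisors k)).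
  by rewrite card_ord.
have [->|k0] := posnP k; first by rewrite exp1n muln_gt0 C0.
by apply: leq_trans (HC k k0) _; rewrite leq_mul2l -ltnS ltn_ord orbT.
Qed.

Lemma max_divs_powR (R : realType) (eps : R) : 0 < eps ->
  exists2 C : R, 0 < C & forall n : nat, (0 < n)%N ->
    (max_divs (((5 * n) ^ 17) ^ 2) ^ 16)%:R <= C * n%:R `^ eps.
Proof.
(* The divisor bound is applied at [(5 * n) ^ 34]; this [r] makes the exponent [34 / r] left by the
   [r]-th root at most [eps]. *)
move=> e0; pose r := (Num.truncn (34 / eps)).+1.
have r0 : 0 < r%:R :> R by rewrite ltr0n.
have re : 34 / r%:R <= eps.
  rewrite ler_pdivrMr// mulrC -ler_pdivrMr//; apply: ltW.
  by case/andP: (truncn_itv (divr_ge0 (ler0n R 34) (ltW e0))).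
have [C C0 HC] := @max_divs_le (16 * r) isT.
pose K : R := (C * 5 ^ 34)%:R; have K0 : 0 < K by rewrite ltr0n muln_gt0 C0 expn_gt0.
exists (K `^ r%:R^-1) => [|n n0]; first exact: powR_gt0.
have nB : (0 < ((5 * n) ^ 17) ^ 2)%N by rewrite !expn_gt0 muln_gt0 n0.
set M := max_divs _; have {HC} : (M ^ (16 * r) <= C * ((5 * n) ^ 17) ^ 2)%N by exact: HC.
rewrite -(ler_nat R) => HM.
have n1 : 1 <= n%:R :> R by rewrite ler1n.
have nn : 0 <= n%:R :> R by rewrite ler0n.
apply: le_trans (_ : K `^ r%:R^-1 * n%:R `^ (34 / r%:R) <= _); last first.
  by rewrite ler_wpM2l ?powR_ge0// ler_powR.
have -> : (M ^ 16)%:R = (((M ^ 16)%:R : R) ^+ r) `^ r%:R^-1.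
  by rewrite -powR_mulrn ?ler0n// -powRrM divff ?powRr1 ?ler0n// gt_eqF.
rewrite powRrM powR_mulrn// -powRM ?(ltW K0) ?exprn_ge0//.
rewrite ge0_ler_powR ?invr_ge0 ?(ltW r0)// ?nnegrE ?mulr_ge0 ?exprn_ge0 ?ler0n//.
rewrite -natrX -expnM; apply: le_trans HM _.
by rewrite /K -natrX -natrM ler_nat -expnM expnMn mulnA.
Qed.

Lemma f4_bound (R : realType) (eps : R) : 0 < eps ->
  exists2 C : R, 0 < C & forall m n : nat, (0 < m)%N -> (0 < n)%N ->
    (f 4 m n)%:R <= C * (n%:R `^ eps *
      (n%:R `^ (3 / 2) / m%:R `^ (5 / 4) + n%:R `^ (6 / 5) / m%:R `^ (3 / 5))).
Proof.
move=> e0; have [C C0 HC] := max_divs_powR e0.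
exists (30 * C) => [|m n m0 n0]; first by rewrite mulr_gt0.
have mR : 0 < m%:R :> R by rewrite ltr0n.
have nR : 0 < n%:R :> R by rewrite ltr0n.
set YA := _ / m%:R `^ (5 / 4); set YB := _ / m%:R `^ (3 / 5).
have YA0 : 0 <= YA by rewrite divr_ge0 ?powR_ge0.
have YB0 : 0 <= YB by rewrite divr_ge0 ?powR_ge0.
have powE (x a : R) k j : 0 < x -> a * k%:R = j%:R -> (x `^ a) ^+ k = x ^+ j.
  by move=> x0 ak; rewrite -powR_mulrn ?powR_ge0// -powRrM ak powR_mulrn// ltW.
have YA4 : YA ^+ 4 * m%:R ^+ 5 = n%:R ^+ 6.
  rewrite expr_div_n (powE _ _ _ 6%N)//; last by lra.
  by rewrite (powE _ _ _ 5%N) ?divfK ?expf_neq0 ?gt_eqF//; lra.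
have YB5 : YB ^+ 5 * m%:R ^+ 3 = n%:R ^+ 6.
  rewrite expr_div_n (powE _ _ _ 6%N)//; last by lra.
  by rewrite (powE _ _ _ 3%N) ?divfK ?expf_neq0 ?gt_eqF//; lra.
(* The factors 10 and 5 are chosen for [10 ^ 4 > 4608] and [5 ^ 5 > 2304]. They lead to the constant
   30, as [3 * 10 = 30] and [4 * 5 <= 30]. *)
have /andP[TA_le TA_gt] := truncn_itv (mulr_ge0 (ler0n R 10) YA0).
have /andP[TB_le TB_gt] := truncn_itv (mulr_ge0 (ler0n R 5) YB0).
set TA := Num.truncn (10 * YA) in TA_le TA_gt.
set TB := Num.truncn (5 * YB) in TB_le TB_gt.
have n6 : 0 < n%:R ^+ 6 :> R by rewrite exprn_gt0.
have hA : (4608 * n ^ 6 < TA.+1 ^ 4 * m ^ 5)%N.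
  rewrite -(ltr_nat R) 2!natrM !natrX.
  apply: (@lt_le_trans _ _ ((10 * YA) ^+ 4 * m%:R ^+ 5)).
    by rewrite exprMn -mulrA YA4 ltr_pM2r// -natrX ltr_nat.
  rewrite ler_wpM2r ?exprn_ge0 ?ler0n// lerXn2r ?nnegrE ?ler0n ?mulr_ge0 ?ler0n//.
  exact: ltW.
have hB : (2304 * n ^ 6 < TB.+1 ^ 5 * m ^ 3)%N.
  rewrite -(ltr_nat R) 2!natrM !natrX.
  apply: (@lt_le_trans _ _ ((5 * YB) ^+ 5 * m%:R ^+ 3)).
    by rewrite exprMn -mulrA YB5 ltr_pM2r// -natrX ltr_nat.
  rewrite ler_wpM2r ?exprn_ge0 ?ler0n// lerXn2r ?nnegrE ?ler0n ?mulr_ge0 ?ler0n//.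
  exact: ltW.
have := f4_le m0 n0 hA hB; rewrite -(ler_nat R) => /le_trans; apply.
rewrite natrM; apply: le_trans (ler_wpM2r _ (HC n n0)) _; first by rewrite ler0n.
rewrite (_ : 30 * C * _ = C * n%:R `^ eps * (30 * (YA + YB))); last by ring.
rewrite ler_wpM2l ?mulr_ge0 ?powR_ge0 ?(ltW C0)//.
by rewrite natrD !natrM; lra.
Qed.

(** * The five ranges of [m] *)

Lemma powR_ratio_le (R : realType) (x y a b d e k : R) : 0 < x -> 0 < y ->
  a * ln x - b * ln y <= k + (d * ln x - e * ln y) ->
  x `^ a / y `^ b <= expR k * (x `^ d / y `^ e).
Proof.
move=> x0 y0 le; rewrite /powR !gt_eqF// -!expRN -!expRD ler_expR.
by lra.
Qed.

Theorem corollary2 (R : realType) (eps : R) (heps : 0 < eps) :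
  (forall c : R, 0 < c ->
     exists2 C : R, 0 < C & forall m n : nat, (0 < m)%N -> (0 < n)%N ->
       m%:R <= c * n%:R `^ (50 / 289) ->
       (f 4 m n)%:R
         <= C * (n%:R `^ eps * (n%:R `^ (3 / 2) / m%:R `^ (3 / 4)))) /\
  (forall c1 c2 : R, 0 < c1 -> 0 < c2 ->
     exists2 C : R, 0 < C & forall m n : nat, (0 < m)%N -> (0 < n)%N ->
       n%:R `^ (50 / 289) <= c1 * m%:R ->
       m%:R <= c2 * n%:R `^ (5 / 17) ->
       (f 4 m n)%:R
         <= C * (n%:R `^ eps * (n%:R `^ (28 / 17) / m%:R `^ (8 / 5)))) /\
  (forall c1 c2 : R, 0 < c1 -> 0 < c2 ->
     exists2 C : R, 0 < C & forall m n : nat, (0 < m)%N -> (0 < n)%N ->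
       n%:R `^ (5 / 17) <= c1 * m%:R ->
       m%:R <= c2 * n%:R `^ (1 / 3) ->
       (f 4 m n)%:R
         <= C * (n%:R `^ eps * (n%:R / m%:R) `^ (5 / 3))) /\
  (forall c1 c2 : R, 0 < c1 -> 0 < c2 ->
     exists2 C : R, 0 < C & forall m n : nat, (0 < m)%N -> (0 < n)%N ->
       n%:R `^ (1 / 3) <= c1 * m%:R ->
       m%:R <= c2 * n%:R `^ (4 / 5) ->
       (f 4 m n)%:R
         <= C * (n%:R `^ eps * (n%:R `^ (4 / 3) / m%:R `^ (2 / 3)))) /\
  (forall c1 c2 : R, 0 < c1 -> 0 < c2 ->
     exists2 C : R, 0 < C & forall m n : nat, (0 < m)%N -> (0 < n)%N ->
       n%:R `^ (4 / 5) <= c1 * m%:R ->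
       m%:R <= c2 * n%:R ->
       (f 4 m n)%:R
         <= C * (n%:R `^ eps * (n%:R `^ (8 / 5) / m%:R))).
Proof.
have [C C0 HC] := f4_bound heps.
(* In logarithms each range reduces to two linear inequalities, one per term of [f4_bound]; [k]
   absorbs the implied constants of the range. *)
have key (d e k : R) m n : (0 < m)%N -> (0 < n)%N ->
    3 / 2 * ln n%:R - 5 / 4 * ln m%:R <= k + (d * ln n%:R - e * ln m%:R) ->
    6 / 5 * ln n%:R - 3 / 5 * ln m%:R <= k + (d * ln n%:R - e * ln m%:R) ->
    (f 4 m n)%:R <= 2 * C * expR k * (n%:R `^ eps * (n%:R `^ d / m%:R `^ e)).
  move=> m0 n0 hA hB; have mR : 0 < m%:R :> R by rewrite ltr0n.
  have nR : 0 < n%:R :> R by rewrite ltr0n.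
  apply: le_trans (HC m n m0 n0) _.
  rewrite (_ : 2 * C * _ * _ = C * (n%:R `^ eps *
    (expR k * (n%:R `^ d / m%:R `^ e) + expR k * (n%:R `^ d / m%:R `^ e)))); last by ring.
  by rewrite !ler_wpM2l ?powR_ge0 ?(ltW C0)// lerD// powR_ratio_le.
have K0 (k : R) : 0 < 2 * C * expR k by rewrite !mulr_gt0 ?expR_gt0.
have ln_ge0 (m : nat) : (0 < m)%N -> 0 <= ln (m%:R : R) by move=> m0; rewrite ln_ge0 ?ler1n.
have up (c al : R) m n : 0 < c -> (0 < m)%N -> (0 < n)%N ->
    m%:R <= c * n%:R `^ al -> ln m%:R <= `|ln c| + al * ln n%:R.
  move=> c0 m0 n0; have nR : 0 < n%:R :> R by rewrite ltr0n.
  move=> h; have : ln m%:R <= ln (c * n%:R `^ al).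
    by rewrite ler_ln ?posrE ?ltr0n ?mulr_gt0 ?powR_gt0.
  rewrite lnM ?posrE ?powR_gt0// ln_powR.
  by move=> /le_trans; apply; rewrite lerD2r ler_norm.
have lo (c al : R) m n : 0 < c -> (0 < m)%N -> (0 < n)%N ->
    n%:R `^ al <= c * m%:R -> al * ln n%:R <= `|ln c| + ln m%:R.
  move=> c0 m0 n0; have nR : 0 < n%:R :> R by rewrite ltr0n.
  move=> h; have : ln (n%:R `^ al) <= ln (c * m%:R).
    by rewrite ler_ln ?posrE ?mulr_gt0 ?powR_gt0 ?ltr0n.
  rewrite lnM ?posrE ?ltr0n// ln_powR.
  by move=> /le_trans; apply; rewrite lerD2r ler_norm.
split.
  move=> c c0; exists (2 * C * expR `|ln c|) => // m n m0 n0 /(up _ _ _ _ c0 m0 n0) h.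
  have x0 := ln_ge0 n n0; have y0 := ln_ge0 m m0; have l0 := normr_ge0 (ln c).
  by apply: key => //; lra.
split.
  (* In this and the next three ranges, multiples of [h1] and [h2] by factors at most 2 suffice,
     hence the 2 in the exponent. *)
  move=> c1 c2 c10 c20; exists (2 * C * expR (2 * (`|ln c1| + `|ln c2|))) => // m n m0 n0.
  move=> /(lo _ _ _ _ c10 m0 n0) h1 /(up _ _ _ _ c20 m0 n0) h2.
  have x0 := ln_ge0 n n0; have y0 := ln_ge0 m m0.
  have l1 := normr_ge0 (ln c1); have l2 := normr_ge0 (ln c2).
  by apply: key => //; lra.
split.
  move=> c1 c2 c10 c20; exists (2 * C * expR (2 * (`|ln c1| + `|ln c2|))) => // m n m0 n0.
  move=> /(lo _ _ _ _ c10 m0 n0) h1 /(up _ _ _ _ c20 m0 n0) h2.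
  have x0 := ln_ge0 n n0; have y0 := ln_ge0 m m0.
  have l1 := normr_ge0 (ln c1); have l2 := normr_ge0 (ln c2).
  rewrite powRM ?invr_ge0 ?ler0n// -[m%:R^-1]powR_inv1 ?ler0n// -powRrM mulN1r powRN.
  by apply: key => //; lra.
split.
  move=> c1 c2 c10 c20; exists (2 * C * expR (2 * (`|ln c1| + `|ln c2|))) => // m n m0 n0.
  move=> /(lo _ _ _ _ c10 m0 n0) h1 /(up _ _ _ _ c20 m0 n0) h2.
  have x0 := ln_ge0 n n0; have y0 := ln_ge0 m m0.
  have l1 := normr_ge0 (ln c1); have l2 := normr_ge0 (ln c2).
  by apply: key => //; lra.
move=> c1 c2 c10 c20; exists (2 * C * expR (2 * (`|ln c1| + `|ln c2|))) => // m n m0 n0.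
move=> /(lo _ _ _ _ c10 m0 n0) h1; rewrite -[X in _ <= c2 * X](powRr1 (ler0n R n)).
move=> /(up _ _ _ _ c20 m0 n0) h2.
have x0 := ln_ge0 n n0; have y0 := ln_ge0 m m0.
have l1 := normr_ge0 (ln c1); have l2 := normr_ge0 (ln c2).
rewrite -[X in _ `^ (8 / 5) / X](powRr1 (ler0n R m)).
by apply: key => //; lra.
Qed.
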